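(* For every integer $d\ge 3$ and every integer $k$ with $2\le k\le 2d-2$ there exists a rational function $f:\hat{\mathbb C}\to\hat{\mathbb C}$ of degree $d$ having an attracting fixed point whose immediate basin of attraction $B$ is completely invariant (i.e. $f^{-1}(B)=B$), is not simply connected, and contains exactly $k$ critical points of $f$.
   Context: $\hat{\mathbb C}$ is the Riemann sphere. Critical points are counted with multiplicities (so a rational map of degree $d$ has $2d-2$ of them). The immediate basin of attraction to an attracting fixed point $p$ is the connected component containing $p$ of the set of points whose forward orbits converge to $p$. Attracting fixed points include superattracting ones. *)

(* Defs.v *)
From HB Require Import structures.
From mathcomp Require Import all_boot all_order all_algebra.
From mathcomp Require Import complex.
From mathcomp Require Import all_classical all_reals all_analysis.

Set Implicit Arguments.
Unset Strict Implicit.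
Unset Printing Implicit Defensive.

Import Order.TTheory GRing.Theory Num.Theory.
Import numFieldNormedType.Exports.

Local Open Scope classical_set_scope.
Local Open Scope ring_scope.

(* R[i], packed so that the norm topology which MathComp-Analysis attaches to
   every numClosedFieldType is inferred on it. *)
Definition cplx (R : realType) : numClosedFieldType := R[i].

(* The Riemann sphere; [None] is the point at infinity. *)
Definition sphere (R : realType) : topologicalType :=
  one_point_compactification (cplx R).

Definition infty {R : realType} : sphere R := None.
Definition finpt {R : realType} (z : cplx R) : sphere R := Some z.

(* A rational function, as a fraction in lowest terms. *)
Record ratfun (R : realType) := RatFun {
  rnum : {poly cplx R};
  rden : {poly cplx R};
  _ : coprimep rnum rden }.

Definition ratdeg (R : realType) (f : ratfun R) : nat :=
  (maxn (size (rnum f)) (size (rden f))).-1.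

(* At infinity the value is read off the coefficients of degree [ratdeg f] of
   the numerator and the denominator, which are not both zero. *)
Definition rat_eval (R : realType) (f : ratfun R) (z : sphere R) : sphere R :=
  let: (a, b) := if z is Some x then ((rnum f).[x], (rden f).[x])
                 else ((rnum f)`_(ratdeg f), (rden f)`_(ratdeg f)) in
  if b == 0 then infty else finpt (a / b).

Coercion rat_eval : ratfun >-> Funclass.

(* The finite preimages of [w] under [f] are the roots of [fiber_poly f w]
   (with multiplicity), and infinity accounts for the drop of its degree below
   [ratdeg f]. *)
Definition fiber_poly (R : realType) (f : ratfun R) (w : sphere R) :
    {poly cplx R} :=
  if w is Some c then rnum f - c *: rden f else rden f.

(* Multiplicity of [z] as a solution of [f _ = f z]. *)
Definition local_degree (R : realType) (f : ratfun R) (z : sphere R) : nat :=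
  if z is Some x then mup x (fiber_poly f (f z))
  else (ratdeg f - (size (fiber_poly f (f z))).-1)%N.

(* Multiplicity of [z] as a critical point; 0 when [z] is not critical. *)
Definition crit_mult (R : realType) (f : ratfun R) (z : sphere R) : nat :=
  (local_degree f z).-1.

(* The sum has finite support as soon as [f] is not constant. *)
Definition num_crit (R : realType) (f : ratfun R) (B : set (sphere R)) : nat :=
  \big[addn/0%N]_(z \in B) crit_mult f z.

(* The chart change z |-> 1/z. *)
Definition sphere_inv (R : realType) (z : sphere R) : sphere R :=
  if z is Some x then (if x == 0 then infty else finpt x^-1) else finpt 0.

Definition affine_coord (R : realType) (z : sphere R) : cplx R := odflt 0 z.

(* Derivative at [p] in the coordinate z, or 1/z when [p] is infinity;
   meaningful when [p] is a fixed point of [f]. *)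
Definition multiplier (R : realType) (f : sphere R -> sphere R) (p : sphere R) :
    cplx R :=
  if p is Some x then derive1 (fun z : cplx R => affine_coord (f (finpt z))) x
  else derive1 (fun w : cplx R =>
          affine_coord (sphere_inv (f (sphere_inv (finpt w))))) 0.

Definition attracting_fixed_point (R : realType) (f : sphere R -> sphere R)
    (p : sphere R) : Prop :=
  f p = p /\ `|multiplier f p| < 1.

Definition basin (R : realType) (f : sphere R -> sphere R) (p : sphere R) :
    set (sphere R) :=
  [set z | (fun n : nat => iter n f z) @ \oo --> p].

Definition immediate_basin (R : realType) (f : sphere R -> sphere R)
    (p : sphere R) : set (sphere R) :=
  connected_component (basin f p) p.

Definition completely_invariant (T : Type) (f : T -> T) (B : set T) : Prop :=
  f @^-1` B = B.

Definition path_in (R : realType) (T : topologicalType) (A : set T)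
    (g : R -> T) : Prop :=
  {within `[0, 1], continuous g} /\ (forall t : R, t \in `[0, 1] -> A (g t)).

Definition path_connected (R : realType) (T : topologicalType) (A : set T) :
    Prop :=
  forall x y, A x -> A y ->
    exists g : R -> T, [/\ path_in A g, g 0 = x & g 1 = y].

(* Homotopy relative to the base point, inside [A], to the constant loop. *)
Definition null_homotopic (R : realType) (T : topologicalType) (A : set T)
    (g : R -> T) : Prop :=
  exists H : R * R -> T,
    [/\ {within `[0, 1] `*` `[0, 1], continuous H},
        forall s t : R, s \in `[0, 1] -> t \in `[0, 1] -> A (H (s, t)),
        forall t : R, t \in `[0, 1] -> H (0, t) = g t /\ H (1, t) = g 0 &
        forall s : R, s \in `[0, 1] -> H (s, 0) = g 0 /\ H (s, 1) = g 0].

Definition simply_connected (R : realType) (T : topologicalType) (A : set T) :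
    Prop :=
  [/\ A !=set0, path_connected R A &
      forall g : R -> T, path_in A g -> g 0 = g 1 -> null_homotopic A g].

(* Main.v *)
Require Import Defs.
From mathcomp Require Import all_boot all_order all_algebra.
From mathcomp Require Import complex ring lra.
From mathcomp Require Import all_classical all_reals all_analysis.

Set Implicit Arguments.
Unset Strict Implicit.
Unset Printing Implicit Defensive.

Import Order.TTheory GRing.Theory Num.Theory.
Import numFieldNormedType.Exports.

Local Open Scope classical_set_scope.
Local Open Scope ring_scope.

(** Two explicit families of maps realise all pairs [d], [k]. In both, infinity is
    a fixed point and 1 is a pole, so that neither belongs to the basin of the
    finite attracting fixed point [p].

    _Not simply connected._ A circle around 1 lies in the basin. The basin avoids
    1 and infinity, and in the plane punctured at 1 such a circle does not
    contract ([circle_not_contractible], [circle_not_simply_connected]).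

    _Complete invariance._ Let [Omega] be the set of all points attracted to [p]
    and [B] its component containing [p]. A rational map is open and proper, so
    it maps the component [U] of a point of [Omega] onto [B] as soon as [f U]
    meets [B] ([component_onto]). If some [w] in [B] has its whole fibre in [B],
    such a [U] meets [B], hence equals [B]. It follows that [B] is all of [Omega]
    ([immediate_basin_eq]), and [Omega] is completely invariant by its very
    definition.

    _Critical points._ Away from the poles of [f = P / Q], critical points are
    the roots of the Wronskian [P' Q - P Q'], with multiplicities, so that it
    suffices to locate its roots ([num_crit_eq]).

    _The maps._ For [d < k], take [beta z^d / (1 - z^j)] with [j = k + 1 - d] and
    [p = 0] ([escaping_realization]). It is a polynomial seen from infinity. The
    point 0 is its own only preimage and has multiplicity [d - 1] as a critical
    point, and a small [beta] brings exactly [j] further critical points into the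
    basin. For [k <= d], take [1 + eta z^m (1 + eps / (z-1)^r)] with [r = k - 1]
    and [m = d - r] ([bubble_realization]): a contraction [1 + eta z^m] perturbed
    in a tiny disc around its critical value 1, which becomes a pole. The critical
    points 0 and 1 end up at infinity, and the other [r + 1] are attracted to
    [p]. *)

(** * The modulus as a real number *)

(** The norm of [cplx R] takes its values in [cplx R], which is only partially
    ordered; estimates are carried out on this real-valued modulus. *)
Definition nrm (R : realType) (z : cplx R) : R := ComplexField.Normc.normc z.

Definition rc (R : realType) (a : R) : cplx R := (a%:C)%C.

Arguments nrm : simpl never.
Arguments rc : simpl never.

Section RealNorm.
Variable R : realType.
Implicit Types (x y z : cplx R) (A : set (cplx R)).

Lemma nrmE z : `|z| = rc (nrm z).
Proof. by []. Qed.

Lemma nrm_sqr z : nrm z ^+ 2 = complex.Re z ^+ 2 + complex.Im z ^+ 2.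
Proof. by case: z => a b; rewrite /nrm /rc /= sqr_sqrtr // addr_ge0 // sqr_ge0. Qed.

Lemma nrm_ge0 z : 0 <= nrm z.
Proof. by case: z => a b; rewrite /nrm /rc /= sqrtr_ge0. Qed.

Lemma nrm0 : nrm (0 : cplx R) = 0.
Proof. exact: ComplexField.Normc.normc0. Qed.

Lemma nrm1 : nrm (1 : cplx R) = 1.
Proof. exact: ComplexField.Normc.normc1. Qed.

Lemma nrmN z : nrm (- z) = nrm z.
Proof. by case: z => a b; rewrite /nrm /rc /= !sqrrN. Qed.

Lemma nrmB x y : nrm (x - y) = nrm (y - x).
Proof. by rewrite -nrmN opprB. Qed.

Lemma nrmM x y : nrm (x * y) = nrm x * nrm y.
Proof. exact: ComplexField.Normc.normcM. Qed.

Lemma nrmX x n : nrm (x ^+ n) = nrm x ^+ n.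
Proof. by elim: n => [|n ih]; rewrite ?expr0 ?nrm1 // !exprS nrmM ih. Qed.

Lemma nrm_eq0 z : (nrm z == 0) = (z == 0).
Proof.
by apply/eqP/eqP => [/ComplexField.Normc.eq0_normc//|->]; exact: nrm0.
Qed.

Lemma nrm_gt0 z : (0 < nrm z) = (z != 0).
Proof. by rewrite lt_def nrm_ge0 andbT nrm_eq0. Qed.

Lemma nrmV z : nrm z^-1 = (nrm z)^-1.
Proof.
have [->|z0] := eqVneq z 0; first by rewrite invr0 nrm0 invr0.
have zn0 : nrm z != 0 by rewrite nrm_eq0.
by apply: (mulfI zn0); rewrite -nrmM !divff // nrm1.
Qed.

Lemma nrm_prod I (s : seq I) (F : I -> cplx R) :
  nrm (\prod_(i <- s) F i) = \prod_(i <- s) nrm (F i).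
Proof. by elim/big_rec2: _ => [|i y x _ <-]; rewrite ?nrm1 ?nrmM. Qed.

Lemma ler_nrmD x y : nrm (x + y) <= nrm x + nrm y.
Proof. exact: le_normcD. Qed.

Lemma ler_nrmBD x y : nrm (x - y) <= nrm x + nrm y.
Proof. by rewrite -(nrmN y) ler_nrmD. Qed.

Lemma ler_nrm_distD y x z : nrm (x - z) <= nrm (x - y) + nrm (y - z).
Proof. by have := ler_nrmD (x - y) (y - z); rewrite addrA subrK. Qed.

Lemma ler_nrmBr x y : nrm x - nrm y <= nrm (x - y).
Proof. by rewrite lerBlDr (le_trans _ (ler_nrmD _ _)) // subrK. Qed.

Lemma ler_nrmDr x y : nrm x - nrm y <= nrm (x + y).
Proof. by have := ler_nrmBr x (- y); rewrite opprK nrmN. Qed.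

Lemma nrm_rc (a : R) : nrm (rc a) = `|a|.
Proof. by rewrite /nrm /rc /= expr0n addr0 sqrtr_sqr. Qed.

Lemma rcD (a b : R) : rc (a + b) = rc a + rc b.
Proof. exact: rmorphD. Qed.

Lemma rcN (a : R) : rc (- a) = - rc a.
Proof. exact: rmorphN. Qed.

Lemma rcM (a b : R) : rc (a * b) = rc a * rc b.
Proof. exact: rmorphM. Qed.

Lemma rcX (a : R) n : rc (a ^+ n) = rc a ^+ n.
Proof. exact: rmorphXn. Qed.

Lemma rcV (a : R) : rc a^-1 = (rc a)^-1.
Proof. exact: (fmorphV (real_complex R)). Qed.

Lemma rc_nat n : n%:R = rc (n%:R : R).
Proof. by elim: n => [//|n ih]; rewrite -!natr1 rcD ih. Qed.

Lemma rc0 : rc (0 : R) = 0.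
Proof. by []. Qed.

Lemma rc1 : rc (1 : R) = 1.
Proof. by []. Qed.

Lemma rc_eq0 (a : R) : (rc a == 0) = (a == 0).
Proof. by rewrite -nrm_eq0 nrm_rc normr_eq0. Qed.

Lemma nrm_nat n : nrm (n%:R : cplx R) = n%:R.
Proof. by rewrite rc_nat nrm_rc normr_nat. Qed.

Lemma nbhs_nrmP z A :
  nbhs z A <-> exists2 e : R, 0 < e & forall y, nrm (y - z) < e -> A y.
Proof.
split=> [|[e e0 eA]].
  move=> /nbhs_normP[e /= e0 eA].
  have er : (e : R[i]) \is Num.real by apply: gtr0_real.
  have /complex_realP[k ek] := er.
  exists k; first by have := e0; rewrite ek ltcR.
  move=> y yk; apply: eA; rewrite /ball_ /= distrC nrmE ek ltcR //.
apply/nbhs_normP; exists (e%:C%C); first by rewrite /= ltcR.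
by move=> y /=; rewrite distrC nrmE ltcR; apply: eA.
Qed.

Lemma nrm_cvgP T (F : set_system T) (FF : Filter F) (f : T -> cplx R) z :
  f @ F --> z <-> forall e : R, 0 < e -> \forall t \near F, nrm (f t - z) < e.
Proof.
split=> [fz e e0|fz].
  apply: (fz (fun y => nrm (y - z) < e)); apply/nbhs_nrmP.
  by exists e.
move=> A /nbhs_nrmP[e e0 eA].
by apply: filterS (fz e e0) => t; apply: eA.
Qed.

End RealNorm.

(** * Winding of the circle *)

Definition cis (R : realType) (x : R) : cplx R := (cos x +i* sin x)%C.

(** The unimodular complex number in the direction of the principal square root
    of [z]; it is continuous away from the nonpositive reals. *)
Definition unit_sqrt (R : realType) (z : cplx R) : cplx R :=
  (z + `|z|) / `|z + `|z| |.

Section Winding.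
Variable R : realType.
Implicit Types (x y : R) (z w : cplx R).

Lemma cisD x y : cis (x + y) = cis x * cis y.
Proof.
rewrite /cis cosD sinD; apply/eqP; rewrite eq_complex /=.
by rewrite addrC eqxx addrC eqxx.
Qed.

Lemma cis0 : cis 0 = 1 :> cplx R.
Proof. by rewrite /cis cos0 sin0. Qed.

Lemma cisMn x n : cis (x *+ n) = cis x ^+ n.
Proof. by elim: n => [|n ih]; rewrite ?mulr0n ?cis0 // mulrS cisD ih exprS. Qed.

Lemma nrm_cis x : nrm (cis x) = 1.
Proof. by rewrite /nrm /= cos2Dsin2 sqrtr1. Qed.

Lemma cis_neq0 x : cis x != 0.
Proof. by rewrite -nrm_eq0 nrm_cis oner_eq0. Qed.

Lemma unit_sqrt_cis x : 0 < cos x -> unit_sqrt (cis (x + x)) = cis x.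
Proof.
move=> cx; rewrite /unit_sqrt nrmE nrm_cis.
have -> : cis (x + x) + 1 = rc (2 * cos x) * cis x.
  rewrite /cis cosD sinD; apply/eqP; rewrite eq_complex /=.
  have := cos2Dsin2 x; rewrite !expr2 => E.
  by apply/andP; split; apply/eqP; lra.
rewrite nrmE nrmM nrm_cis mulr1 nrm_rc gtr0_norm ?mulr_gt0 //.
rewrite mulrC mulKf // rc_eq0.
by rewrite mulf_eq0 (gt_eqF cx) pnatr_eq0.
Qed.

Lemma norm_add_neq0 z : nrm (z - 1) < 1 -> z + `|z| != 0.
Proof.
apply: contraTneq => /eqP; rewrite addr_eq0 => /eqP zE.
rewrite -leNgt zE -opprD nrmN nrmE -rc1 -rcD nrm_rc.
by rewrite ger0_norm ?addr_ge0 ?ler01 ?nrm_ge0 // lerDr nrm_ge0.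
Qed.

Lemma unit_sqrt_sqr z : nrm (z - 1) < 1 -> unit_sqrt z ^+ 2 = z / `|z|.
Proof.
move=> z1; have w0 := norm_add_neq0 z1.
have z0 : z != 0.
  by apply: contraTneq z1 => ->; rewrite sub0r nrmN nrm1 ltxx.
rewrite /unit_sqrt; set w := z + `|z| in w0 *.
rewrite exprMn exprVn normCK.
(* the key identity is [w / w^* = z / |z|] *)
have wJ0 : w^* != 0 by rewrite conjC_eq0.
have : w * `|z| = z * w^*.
  rewrite /w rmorphD /= conj_normC mulrDl mulrDr -(expr2 `|z|) normCK.
  by rewrite addrC.
move=> E; apply/eqP; rewrite expr2 invfM mulrA mulfK // eq_sym.
by rewrite eqr_div ?normr_eq0 // -E mulrC.
Qed.

Lemma unit_sqrt1 : unit_sqrt 1 = 1 :> cplx R.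
Proof. by have := @unit_sqrt_cis 0; rewrite addr0 cis0 cos0 ltr01 => ->. Qed.

Lemma unit_sqrt_cvg (T : Type) (F : set_system T) (FF : Filter F)
    (f : T -> cplx R) z : nrm (z - 1) < 1 ->
  f @ F --> z -> unit_sqrt (f t) @[t --> F] --> unit_sqrt z.
Proof.
move=> z1 fz; have w0 := norm_add_neq0 z1.
have N (g : T -> cplx R) (y : cplx R) : g @ F --> y -> `|g t| @[t --> F] --> (`|y| : cplx R).
  by move=> gy; exact: (@cvg_norm (cplx R) (cplx R)).
have D : (f t + `|f t|) @[t --> F] --> z + `|z|.
  by apply: (@cvgD (cplx R) (cplx R)); [exact: fz|exact: N].
apply: (@cvgM (cplx R)); first exact: D.
by apply: (@cvgV (cplx R)); [rewrite normr_eq0|exact: N].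
Qed.

Lemma cvg_prod_seq (T : Type) (F : set_system T) (FF : Filter F) (I : eqType)
    (r : seq I) (f : I -> T -> cplx R) (l : I -> cplx R) :
  {in r, forall i, f i @ F --> l i} ->
  \prod_(i <- r) f i t @[t --> F] --> \prod_(i <- r) l i.
Proof.
elim: r => [|i r ih] fl.
  by rewrite big_nil; under eq_fun do rewrite big_nil; apply: cvg_cst.
rewrite big_cons; under eq_fun do rewrite big_cons.
apply: (@cvgM (cplx R)); first by apply: fl; rewrite mem_head.
by apply: ih => j jr; apply: fl; rewrite in_cons jr orbT.
Qed.

Let I01 : set R := `[0, 1].

(** By compactness of the square, a small step in the second variable changes
    [h] by a factor at distance less than 1 from 1, uniformly; this makes [unit_sqrt] applicable to
    the ratios of consecutive values. *)
Lemma near_ratio (h : R * R -> cplx R) :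
  {within I01 `*` I01, continuous h} ->
  (forall s t, I01 s -> I01 t -> h (s, t) != 0) ->
  exists2 e : R, 0 < e & forall s t t', I01 s -> I01 t -> I01 t' ->
    `|t' - t| < e -> nrm (h (s, t') / h (s, t) - 1) < 1.
Proof.
move=> /subspace_continuousP hc h0.
have K : compact (I01 `*` I01) by apply: compact_setX; exact: segment_compact.
move/compact_near_coveringP/near_covering_withinP : K.
move=> /(_ R (0 : R)^'+ (fun e (p : R * R) => forall t', I01 t' ->
    `|t' - p.2| < e -> nrm (h (p.1, t') - h p) < nrm (h p)) _).
case.
- case=> s t [/= Is It].
  have d0 : 0 < nrm (h (s, t)) / 3 by rewrite divr_gt0 // nrm_gt0 h0.
  have /nrm_cvgP/(_ _ d0) := hc (s, t) (conj Is It).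
  rewrite /within /= nearE => /nbhs_ballP[r /= r0 hr].
  exists (ball (s, t) (r / 2), [set e | e < r / 2]) => /=.
    split; first by apply: nbhsx_ballx; rewrite divr_gt0.
    by apply: nbhs_right_lt; rewrite divr_gt0.
  move=> [[s1 t1] e] /= [[/= b1 b2] er] [/= Is1 It1] t' It' t'e.
  have h1 : nrm (h (s1, t1) - h (s, t)) < nrm (h (s, t)) / 3.
    apply: hr => //; split => /=; apply: le_ball; try eassumption;
    by rewrite ler_pdivrMr // ler_peMr ?ler1n // ltW.
  have h2 : nrm (h (s1, t') - h (s, t)) < nrm (h (s, t)) / 3.
    apply: hr => //; split => /=.
      by apply: le_ball b1; rewrite ler_pdivrMr // ler_peMr ?ler1n // ltW.
    rewrite /ball /= in b2 *; rewrite distrC.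
    have -> : t' - t = (t' - t1) - (t - t1) by ring.
    rewrite (le_lt_trans (ler_normB _ _)) // (splitr r) ltrD //.
    exact: lt_trans er.
  have := ler_nrm_distD (h (s, t)) (h (s1, t')) (h (s1, t1)).
  have := ler_nrmD (h (s1, t1)) (h (s, t) - h (s1, t1)).
  rewrite addrC subrK (nrmB (h (s, t))).
  lra.
- move=> r /= r0 re.
  have r20 : 0 < r / 2 by rewrite divr_gt0.
  exists (r / 2) => // s t t' Is It It' tt'.
  have -> : h (s, t') / h (s, t) - 1 = (h (s, t') - h (s, t)) / h (s, t).
    by rewrite mulrBl divff // h0.
  rewrite nrmM nrmV ltr_pdivrMr ?nrm_gt0 ?h0 // mul1r.
  apply: (re (r / 2) _ _ (s, t)) => //=.
  by rewrite sub0r normrN ger0_norm ?ltW // ltr_pdivrMr // ltr_pMr // ltr1n.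
Qed.

(** A circle around 0 does not contract in the punctured plane. Cut the loop
    [h (s, -)] into [n] short arcs and let [P s] be the product of the
    [unit_sqrt] of the ratios of consecutive values. The square of [P s] is the
    telescoping product of these ratios up to positive factors, hence 1 for a
    loop. So [P] is continuous with values in 1 and -1, thus constant: it is the
    parity of the winding number. But [P] is -1 on a circle run through once
    and 1 on a constant loop. *)
Lemma circle_not_contractible (rho : R) (h : R * R -> cplx R) : 0 < rho ->
  {within I01 `*` I01, continuous h} ->
  (forall s t, I01 s -> I01 t -> h (s, t) != 0) ->
  (forall t, I01 t -> h (0, t) = rc rho * cis (t * (pi *+ 2))) ->
  (forall t, I01 t -> h (1, t) = h (1, 0)) ->
  (forall s, I01 s -> h (s, 0) = h (s, 1)) -> False.
Proof.
move=> rho0 hc h0 hcis hcst hloop.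
have [e e0 he] := near_ratio hc h0.
have I0 : I01 0 by rewrite /I01 /= in_itv /= lexx ler01.
have I1 : I01 1 by rewrite /I01 /= in_itv /= lexx ler01.
pose n := (Num.truncn e^-1 + 3)%N.
have n0 : 0 < n%:R :> R by rewrite ltr0n /n addn3.
have n3 : 3 <= n%:R :> R by rewrite ler_nat /n addn3.
have en : n%:R^-1 < e.
  rewrite -[ltRHS]invrK ltf_pV2 ?posrE ?invr_gt0 //.
  apply: lt_le_trans (truncnS_gt _) _; rewrite ler_nat /n addn3 ltnS.
  by rewrite -addn2 leq_addr.
pose c (i : nat) : R := i%:R / n%:R.
have Ic i : (i <= n)%N -> I01 (c i).
  move=> ni; rewrite /I01 /= in_itv /= /c divr_ge0 ?ler0n //=.
  by rewrite ler_pdivrMr // mul1r ler_nat.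
have cS i : c i.+1 = c i + n%:R^-1 by rewrite /c -natr1 mulrDl mul1r.
have hr i s : I01 s -> (i < n)%N -> nrm (h (s, c i.+1) / h (s, c i) - 1) < 1.
  move=> Is ni; apply: he; [exact: Is|exact/Ic/ltnW|exact: Ic|].
  by rewrite cS addrC addKr ger0_norm // invr_ge0 ltW.
pose P s := \prod_(i < n) unit_sqrt (h (s, c i.+1) / h (s, c i)).
have P2 s : I01 s -> P s ^+ 2 = 1.
  move=> Is; rewrite /P -prodrXl.
  pose u i := h (s, c i) / `|h (s, c i)|.
  have u0 i : (i <= n)%N -> u i != 0.
    by move=> ni; rewrite mulf_neq0 ?invr_eq0 ?normr_eq0 //; apply: h0 => //; exact: Ic.
  transitivity (\prod_(0 <= i < n) (u i.+1 / u i)).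
    rewrite big_mkord; apply: eq_bigr => i _.
    rewrite unit_sqrt_sqr ?hr //.
    by rewrite /u normrM normfV !invfM invrK mulrACA.
  have n_gt0 : (0 < n)%N by rewrite /n addn3.
  rewrite telescope_prodf //; last by move=> k /andP[_ kn]; rewrite u0 // ltnW.
  have -> : u n = u 0%N; last by rewrite divff // u0.
  by rewrite /u /c mul0r divff ?gt_eqF // hloop.
(* each of the [n] arcs contributes half its angle, [pi / n] *)
have P0 : P 0 = -1.
  pose x := pi / n%:R : R.
  have cx : 0 < cos x.
    apply: cos_gt0_pihalf; rewrite /x; apply/andP; split.
      rewrite (@lt_trans _ _ 0) ?divr_gt0 ?pi_gt0 //.
      by rewrite oppr_lt0 divr_gt0 ?pi_gt0.
    rewrite ltr_pM2l ?pi_gt0 // ltf_pV2 ?posrE //.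
    by rewrite (lt_le_trans _ n3) // ltr_nat.
  have -> : P 0 = \prod_(i < n) cis x.
    apply: eq_bigr => i _; rewrite -unit_sqrt_cis //; congr unit_sqrt.
    rewrite (hcis _ (Ic _ (ltn_ord i))) (hcis _ (Ic _ (ltnW (ltn_ord i)))).
    rewrite cS mulrDl.
    have -> : n%:R^-1 * (pi *+ 2) = x + x by rewrite /x mulr2n; ring.
    rewrite [cis (_ + (x + x))]cisD mulrA [X in X / _]mulrC mulfK // mulf_neq0 ?cis_neq0 //.
    by rewrite -nrm_gt0 nrm_rc normr_gt0 gt_eqF.
  rewrite prodr_const card_ord -cisMn.
  have -> : x *+ n = pi by rewrite -[LHS]mulr_natr divfK // gt_eqF.
  by rewrite /cis cospi sinpi; apply/eqP; rewrite eq_complex /= oppr0 !eqxx.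
have P1 : P 1 = 1.
  rewrite /P big1 // => i _.
  rewrite (hcst _ (Ic _ (ltn_ord i))) (hcst _ (Ic _ (ltnW (ltn_ord i)))).
  rewrite divff; last exact: h0.
  exact: unit_sqrt1.
have Pc : {within I01, continuous (fun s => complex.Re (P s))}.
  apply/subspace_continuousP => s Is.
  have {}hc k : (k <= n)%N -> h (x, c k) @[x --> within I01 (nbhs s)] --> h (s, c k).
    move=> kn; apply/nrm_cvgP => d d0.
    move/subspace_continuousP : hc => /(_ (s, c k) (conj Is (Ic _ kn))).
    move=> /nrm_cvgP/(_ _ d0).
    rewrite /within /= => /nbhs_ballP[r /= r0 hr'].
    apply/nbhs_ballP; exists r => //= x xr Ix; apply: hr'; split => //=.
    - exact: ballxx.
    - exact: Ic.
  have {}Pc : P x @[x --> within I01 (nbhs s)] --> P s.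
    rewrite /P; apply: cvg_prod_seq => i _.
    apply: unit_sqrt_cvg; first exact: hr.
    apply: (@cvgM (cplx R)); first exact: hc.
    apply: (@cvgV (cplx R)); first exact: (h0 _ _ Is (Ic _ (ltnW _))).
    exact: hc (ltnW _).
  apply/cvgrPdist_lt => d d0.
  move/nrm_cvgP : Pc => /(_ _ d0); apply: filterS => x.
  apply: le_lt_trans; rewrite distrC -raddfB.
  by case: (P x - P s) => a b; rewrite /nrm /= -sqrtr_sqr ler_wsqrtr // lerDl sqr_ge0.
have [|s Is] := @IVT R _ 0 1 0 ler01 Pc.
  by rewrite P0 P1 /= ge_min le_max oppr_le0 ler01 orbT.
have Is' : I01 s by [].
have /eqP := P2 s Is'; rewrite -subr_eq0 subr_sqr_1 mulf_eq0.
by rewrite subr_eq0 addr_eq0 => /orP[] /eqP -> /= /eqP; rewrite ?oppr_eq0 oner_eq0.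
Qed.

End Winding.

(** * The sphere near finite points *)

Section SphereTopology.
Variable R : realType.
Implicit Types (z a : cplx R).

Lemma finpt_continuous : continuous (@finpt R).
Proof. exact: one_point_compactification_some_continuous. Qed.

Lemma nbhs_finptP z (U : set (sphere R)) :
  nbhs (finpt z) U <->
  exists2 e : R, 0 < e & forall y, nrm (y - z) < e -> U (finpt y).
Proof.
split=> [/finpt_continuous/nbhs_nrmP //|zU].
have /nbhs_nrmP/one_point_compactification_some_nbhs := zU.
by apply: filterS => _ [y Uy <-].
Qed.

Lemma finpt_cvgP (T : Type) (F : set_system T) (FF : Filter F)
    (u : T -> sphere R) z :
  u @ F --> finpt z <-> forall e : R, 0 < e ->
    \forall t \near F, exists2 y, u t = finpt y & nrm (y - z) < e.
Proof.
split=> [uz e e0|uz U /nbhs_finptP[e e0 eU]].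
  apply: (uz [set w | exists2 y, w = finpt y & nrm (y - z) < e]).
  by apply/nbhs_finptP; exists e => // y ye; exists y.
by apply: filterS (uz e e0) => t [y uy /eU]; rewrite /= uy.
Qed.

Lemma cis_continuous : continuous (@cis R).
Proof.
move=> x; apply/nrm_cvgP => e e0.
have e20 : 0 < e / 2 by rewrite divr_gt0.
have /cvgrPdist_lt/(_ _ e20) c := @continuous_cos R x.
have /cvgrPdist_lt/(_ _ e20) s := @continuous_sin R x.
near=> y.
have cy : `|cos x - cos y| < e / 2 by near: y.
have sy : `|sin x - sin y| < e / 2 by near: y.
have -> : cis y - cis x = rc (cos y - cos x) + rc (sin y - sin x) * 'i%C.
  rewrite /cis /rc; apply/eqP; rewrite eq_complex /=.
  by apply/andP; split; apply/eqP; ring.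
rewrite (le_lt_trans (ler_nrmD _ _)) // nrmM !nrm_rc.
have -> : nrm 'i%C = 1 :> R by rewrite /nrm /= expr0n add0r expr1n sqrtr1.
by rewrite mulr1 (splitr e) ltrD // distrC.
Unshelve. all: by end_near. Qed.

(** A homotopy inside [B] avoids both infinity and [a], so its affine
    coordinate minus [a] contradicts [circle_not_contractible]. *)
Lemma circle_not_simply_connected (B : set (sphere R)) a (rho : R) :
  0 < rho -> ~ B infty -> ~ B (finpt a) ->
  (forall z, nrm (z - a) = rho -> B (finpt z)) ->
  ~ simply_connected R B.
Proof.
move=> rho0 Boo Ba Bc [_ _ Bnull].
pose g (t : R) : sphere R := finpt (a + rc rho * cis (t * (pi *+ 2))).
have Bg t : B (g t).
  by apply: Bc; rewrite addrC addKr nrmM nrm_cis mulr1 nrm_rc gtr0_norm.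
have gc : continuous g.
  move=> t; apply: (@cvg_comp _ _ _ (fun t => a + rc rho * cis (t * (pi *+ 2)))
    finpt _ _ _ _ (@finpt_continuous _)).
  apply: (@cvgD (cplx R) (cplx R)); first exact: cvg_cst.
  apply: (@cvgM (cplx R)); first exact: cvg_cst.
  apply: (@cvg_comp _ _ _ (fun t => t * (pi *+ 2)) (@cis R) _ _ _ _
    (@cis_continuous _)).
  exact: mulrr_continuous.
have g01 : g 0 = g 1.
  by rewrite /g mul0r mul1r cis0 /cis cos2pi sin2pi.
have [|H [Hc HB Hg Hend]] := Bnull g _ g01.
  by split=> [|t _]; [exact: continuous_subspaceT|exact: Bg].
have Hfin s t : s \in `[0, 1] -> t \in `[0, 1] ->
    exists2 z, H (s, t) = finpt z & z != a.
  move=> sI tI; have := HB s t sI tI; case: (H (s, t)) => [z Bz|//].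
  by exists z => //; apply: contra_notN Ba => /eqP <-.
pose h p := affine_coord (H p) - a.
apply: (@circle_not_contractible R rho h) => //.
- apply/subspace_continuousP => -[s t] [/= sI tI].
  move/subspace_continuousP : Hc => /(_ (s, t) (conj sI tI)).
  have [z Hz _] := Hfin s t sI tI.
  rewrite /h /= => Hcv; apply/nrm_cvgP => e e0.
  move: Hcv; rewrite /from_subspace Hz => /finpt_cvgP/(_ e e0).
  apply: filterS => p [y -> /=].
  by rewrite opprB addrA subrK.
- move=> s t sI tI; have [z Hz za] := Hfin s t sI tI.
  by rewrite /h Hz /= subr_eq0.
- by move=> t /Hg[Ht _]; rewrite /h Ht /= addrC addKr.
- move=> t tI; rewrite /h; have [_ ->] := Hg t tI.
  have I0 : (0 : R) \in `[0, 1] by rewrite in_itv /= lexx ler01.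
  by have [_ ->] := Hg 0 I0.
- by move=> s sI; rewrite /h; have [-> ->] := Hend s sI.
Qed.

End SphereTopology.

(** * Fibres of a rational map fixing infinity *)

Section Fibers.
Variables (R : realType) (f : ratfun R).
Hypothesis f_oo : (size (rden f) < size (rnum f))%N.
Implicit Types (x y z : cplx R).

Lemma rat_eval_infty : f infty = infty.
Proof.
rewrite /= /rat_eval /ratdeg (maxn_idPl (ltnW f_oo)).
rewrite [(rden f)`_ _]nth_default /= ?eqxx //.
by case: (size (rnum f)) f_oo.
Qed.

Lemma rat_eval_finP z y :
  f (finpt z) = finpt y <-> (rden f).[z] != 0 /\ (rnum f).[z] = y * (rden f).[z].
Proof.
rewrite /= /rat_eval /=; case: eqVneq => Qz; first by split=> [H|[]]; first discriminate H.
split=> [[<-]|[_ ->]]; first by rewrite divfK.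
by rewrite mulfK.
Qed.

(** As the numerator has the larger degree, the polynomial [P - y Q] has the
    leading coefficient and the degree of [P] for every finite [y]; its roots
    are exactly the fibre of [y]. *)
Lemma fiber_factor y : exists r : seq (cplx R),
  [/\ forall z, z \in r -> f (finpt z) = finpt y,
      size r = (size (rnum f)).-1 &
      forall x, (rnum f).[x] - y * (rden f).[x] =
                lead_coef (rnum f) * \prod_(z <- r) (x - z)].
Proof.
pose p := rnum f - y *: rden f.
have szp : (size (y *: rden f) < size (rnum f))%N.
  exact: leq_ltn_trans (size_scale_leq _ _) f_oo.
have lp : lead_coef p = lead_coef (rnum f).
  by rewrite /p lead_coefDl // size_polyN.
have [r pE] := closed_field_poly_normal p.
have hp x : (rnum f).[x] - y * (rden f).[x] =
    lead_coef (rnum f) * \prod_(z <- r) (x - z).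
  rewrite -lp -hornerZ -hornerN -hornerD -/p {1}pE hornerZ horner_prod.
  by congr (_ * _); apply: eq_bigr => z _; rewrite hornerXsubC.
have szr : size r = (size (rnum f)).-1.
  have l0 : lead_coef p != 0.
    by rewrite lp lead_coef_eq0 -size_poly_gt0 (leq_ltn_trans _ f_oo).
  have : size p = size (rnum f) by rewrite /p size_polyDl // size_polyN.
  by rewrite pE size_scale // size_prod_XsubC => <-.
exists r; split=> // z zr; apply/rat_eval_finP.
have Pz : (rnum f).[z] = y * (rden f).[z].
  apply/eqP; rewrite -subr_eq0 hp; apply/eqP.
  rewrite (perm_big _ (perm_to_rem zr)) big_cons /= subrr mul0r mulr0 //.
split=> //; apply/negP => /eqP Qz.
case: (f) Qz Pz => P Q /= cPQ Qz.
by rewrite Qz mulr0 => /eqP Pz; have := coprimep_root cPQ Pz; rewrite Qz eqxx.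
Qed.

Lemma lead_num_neq0 : lead_coef (rnum f) != 0.
Proof. by rewrite lead_coef_eq0 -size_poly_gt0 (leq_ltn_trans _ f_oo). Qed.

(** Openness: for [y'] near [y = f x], the product of the distances from [x] to
    the points of the fibre of [y'] is [|y - y'| |Q x| / |lead P|], which is
    small, so one of these distances is small. *)
Lemma rat_eval_open x y (e : R) : 0 < e -> f (finpt x) = finpt y ->
  exists2 d : R, 0 < d & forall y', nrm (y' - y) < d ->
    exists2 x', nrm (x' - x) < e & f (finpt x') = finpt y'.
Proof.
move=> e0 /rat_eval_finP[Qx Px].
have l0 := lead_num_neq0.
have lQ : 0 < nrm (rden f).[x] by rewrite nrm_gt0.
exists (nrm (lead_coef (rnum f)) * e ^+ (size (rnum f)).-1 / nrm (rden f).[x]).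
  by rewrite divr_gt0 // mulr_gt0 ?nrm_gt0 // exprn_gt0.
move=> y' y'd; have [r [fr szr hr]] := fiber_factor y'.
have [[x' x'e /fr]|H] := pselect (exists2 x', nrm (x' - x) < e & x' \in r).
  by exists x'.
exfalso; move: y'd; apply/negP; rewrite -leNgt ler_pdivrMr //.
rewrite nrmB -nrmM mulrBl -Px hr nrmM ler_wpM2l ?nrm_ge0 // nrm_prod.
have -> : e ^+ (size (rnum f)).-1 = \prod_(z <- r) e.
  by rewrite -szr big_const_seq count_predT iter_mulr_1.
rewrite !big_seq; apply: ler_prod => z zr; rewrite ltW //= nrmB leNgt.
by apply/negP => ze; apply: H; exists z.
Qed.

Lemma nrm_horner_le (p : {poly cplx R}) n : (size p <= n.+1)%N ->
  exists2 K : R, 0 <= K & forall x, nrm p.[x] <= K * (nrm x + 1) ^+ n.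
Proof.
move=> pn; exists (\sum_(i < n.+1) nrm p`_i).
  by apply: sumr_ge0 => i _; exact: nrm_ge0.
move=> x; rewrite (horner_coef_wide _ pn) mulr_suml.
apply: (@le_trans _ _ (\sum_(i < n.+1) nrm (p`_i * x ^+ i))).
  elim/big_rec2: _ => [|i a b _ ba]; first by rewrite nrm0.
  by rewrite (le_trans (ler_nrmD _ _)) // lerD2l.
apply: ler_sum => i _; rewrite nrmM nrmX ler_wpM2l ?nrm_ge0 //.
have x1 : 1 <= nrm x + 1 by rewrite lerDr nrm_ge0.
apply: (@le_trans _ _ ((nrm x + 1) ^+ i)).
  by rewrite lerXn2r ?nnegrE ?nrm_ge0 ?addr_ge0 ?nrm_ge0 // lerDl.
by rewrite ler_weXn2l // -ltnS.
Qed.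

(** Properness over finite points: if [f x] is close to [y], then [x] is close
    to a point [z] of the fibre of [y], in a sense that may depend on [z]. This
    is uniform in [x], which may be near infinity or near a pole: if [x] stayed
    at distance at least [e z] from each [z] in the fibre, then [|Q x|] would be
    at most a constant times the product of these distances, while that product
    equals [|f x - y| |Q x| / |lead P|]. *)
Lemma rat_eval_closed y (e : cplx R -> R) : (forall z, 0 < e z) ->
  exists2 d : R, 0 < d & forall x y', f (finpt x) = finpt y' ->
    nrm (y' - y) < d ->
    exists2 z, f (finpt z) = finpt y & nrm (x - z) < e z.
Proof.
move=> e0; have [r [fr szr hr]] := fiber_factor y.
have [K K0 hK] : exists2 K : R, 0 <= K &
    forall x, nrm (rden f).[x] <= K * (nrm x + 1) ^+ size r.
  by apply: nrm_horner_le; rewrite szr; case: (size (rnum f)) f_oo => // n; exact: ltnW.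
have l0 : 0 < nrm (lead_coef (rnum f)) by rewrite nrm_gt0 lead_num_neq0.
pose c z := 1 + (nrm z + 1) / e z.
have c0 z : 0 < c z by rewrite ltr_pwDl // divr_ge0 ?addr_ge0 ?nrm_ge0 // ltW.
have hc x z : e z <= nrm (x - z) -> nrm x + 1 <= c z * nrm (x - z).
  move=> ex; rewrite mulrDl mul1r (@le_trans _ _ (nrm (x - z) + (nrm z + 1))) //.
    by rewrite addrA lerD2r -{1}(subrK z x) ler_nrmD.
  rewrite lerD2l -mulrA ler_peMr ?addr_ge0 ?nrm_ge0 //.
  by rewrite mulrC ler_pdivlMr // mul1r.
have C0 : 0 < \prod_(z <- r) c z by rewrite prodr_gt0.
exists (nrm (lead_coef (rnum f)) / ((K + 1) * \prod_(z <- r) c z)).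
  by rewrite divr_gt0 // mulr_gt0 // ltr_wpDl.
move=> x y' /rat_eval_finP[Qx Px].
have [[z zr ze] _|H] := pselect (exists2 z, z \in r & nrm (x - z) < e z).
  by exists z => //; exact: fr.
rewrite ltNge => /negP[]; rewrite ler_pdivrMr; last first.
  by rewrite mulr_gt0 // ltr_wpDl.
have Q0 : 0 < nrm (rden f).[x] by rewrite nrm_gt0.
rewrite -(ler_pM2r Q0) mulrAC -(nrmM (y' - y)) mulrBl -Px hr nrmM -mulrA ler_wpM2l ?nrm_ge0 //.
rewrite nrm_prod (le_trans (hK x)) //.
have -> : (nrm x + 1) ^+ size r = \prod_(z <- r) (nrm x + 1).
  by rewrite big_const_seq count_predT iter_mulr_1.
rewrite mulrCA ler_pM // ?lerDl //.
  by apply: prodr_ge0 => z _; rewrite addr_ge0 ?nrm_ge0.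
rewrite -big_split /= !big_seq; apply: ler_prod => z zr.
rewrite addr_ge0 ?nrm_ge0 //= mulrC hc // leNgt.
by apply/negP => ze; apply: H; exists z.
Qed.

End Fibers.

(** * Basins of attraction *)

Lemma segment_component (R : realType) (A : set (sphere R)) (x v : cplx R) :
  (forall t : R, 0 <= t <= 1 -> A (finpt (x + rc t * v))) ->
  connected_component A (finpt x) (finpt (x + v)).
Proof.
move=> Axv; pose g (t : R) : sphere R := finpt (x + rc t * v).
have gc : continuous g.
  move=> t; apply: (@cvg_comp _ _ _ (fun t => x + rc t * v)
    finpt _ _ _ _ (@finpt_continuous _ _)).
  apply: (@cvgD (cplx R) (cplx R)); first exact: cvg_cst.
  apply: (@cvgM (cplx R)); last exact: cvg_cst.
  apply/nrm_cvgP => e e0; apply/nbhs_ballP; exists e => // s.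
  by rewrite /ball /= -rcN -rcD nrm_rc distrC.
exists (g @` `[0, 1]); last first.
  exists 1; rewrite /= ?in_itv /= ?lexx ?ler01 //.
  by rewrite /g rc1 mul1r.
split.
- by exists 0; rewrite /= ?in_itv /= ?lexx ?ler01 // /g rc0 mul0r addr0.
- by move=> _ [t + <-]; rewrite /= in_itv /=; exact: Axv.
- apply: connected_continuous_connected; first exact: segment_connected.
  exact: continuous_subspaceT.
Qed.

Lemma nrm_horner_continuous (R : realType) (q : {poly cplx R}) (z : cplx R)
    (e : R) : 0 < e -> exists2 d : R, 0 < d &
  forall x, nrm (x - z) < d -> nrm (q.[x] - q.[z]) < e.
Proof.
move=> e0; have /factor_theorem[q' q'E] : root (q - q.[z]%:P) z by rewrite /root !hornerE subrr.
have [K K0 hK] := nrm_horner_le (leqnSn (size q')).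
pose M := K * (nrm z + 1 + 1) ^+ size q'.
have M0 : 0 <= M by rewrite mulr_ge0 // exprn_ge0 // !addr_ge0 ?nrm_ge0.
exists (Num.min 1 (e / (M + 1))).
  by rewrite lt_min ltr01 divr_gt0 // ltr_wpDl.
move=> x; rewrite lt_min => /andP[x1 xe].
have -> : q.[x] - q.[z] = q'.[x] * (x - z).
  by have := congr1 (horner^~ x) q'E; rewrite !hornerE.
have qM : nrm q'.[x] <= M.
  rewrite (le_trans (hK x)) // ler_wpM2l //.
  rewrite lerXn2r ?nnegrE ?addr_ge0 ?nrm_ge0 // lerD2r.
  by rewrite -{1}(subrK z x) addrC (le_trans (ler_nrmD _ _)) // lerD2l ltW.
rewrite nrmM; apply: (@le_lt_trans _ _ (M * nrm (x - z))).
  by rewrite ler_wpM2r ?nrm_ge0.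
apply: (@le_lt_trans _ _ ((M + 1) * nrm (x - z))).
  by rewrite ler_wpM2r ?nrm_ge0 // lerDl.
by rewrite mulrC -ltr_pdivlMr // ltr_wpDl.
Qed.

(** Requiring a finite image also says that [S] contains no pole. *)
Definition contracts_on (R : realType) (f : sphere R -> sphere R) (p : cplx R)
    (kappa : R) (S : set (cplx R)) : Prop :=
  forall z, S z -> exists2 y, f (finpt z) = finpt y &
    S y /\ nrm (y - p) <= kappa * nrm (z - p).

Section Basin.
Variables (R : realType) (f : ratfun R) (p : cplx R).
Hypothesis f_oo : (size (rden f) < size (rnum f))%N.
Implicit Types (x y z : cplx R).

Lemma basin_iter n (x : sphere R) :
  basin f (finpt p) (iter n f x) <-> basin f (finpt p) x.
Proof.
rewrite /basin /=; under eq_fun do rewrite -iterD.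
by rewrite (cvg_shiftn n (fun m => iter m f x)).
Qed.

Lemma basin_f (x : sphere R) : basin f (finpt p) (f x) <-> basin f (finpt p) x.
Proof. exact: (basin_iter 1). Qed.

Lemma infty_notin_basin : ~ basin f (finpt p) infty.
Proof.
have it n : iter n f infty = infty.
  by elim: n => //= n ->; exact: rat_eval_infty.
rewrite /basin /=; under eq_fun do rewrite it.
move=> /finpt_cvgP/(_ 1 ltr01)[n _ /(_ n (leqnn n))[y]] //.
Qed.

Lemma basin_finite (x : sphere R) : basin f (finpt p) x ->
  exists z, x = finpt z.
Proof. by case: x => [z|/infty_notin_basin //]; exists z. Qed.

Lemma pole_notin_basin z : (rden f).[z] = 0 -> ~ basin f (finpt p) (finpt z).
Proof.
move=> Qz /basin_f; have -> : f (finpt z) = infty; last exact: infty_notin_basin.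
by rewrite /= /rat_eval /= Qz eqxx.
Qed.

Variables (kappa : R).
Hypothesis k01 : 0 <= kappa < 1.

Lemma contracts_basin S z :
  contracts_on f p kappa S -> S z -> basin f (finpt p) (finpt z).
Proof.
move=> fS Sz; have /andP[k0 k1] := k01.
have it n : exists2 y, iter n f (finpt z) = finpt y &
    S y /\ nrm (y - p) <= nrm (z - p) * kappa ^+ n.
  elim: n => [|n [y Ey [Sy yp]]]; first by exists z => //; rewrite expr0 mulr1.
  have [y' fy' [Sy' y'p]] := fS y Sy.
  exists y'; first by rewrite iterS Ey.
  split=> //; apply: le_trans y'p _.
  by rewrite exprS mulrCA ler_wpM2l.
apply/finpt_cvgP => e e0.
have : nrm (z - p) * kappa ^+ n @[n --> \oo] --> (0 : R).
  rewrite -[X in _ --> X](mulr0 (nrm (z - p))); apply: cvgM; first exact: cvg_cst.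
  by apply: cvg_expr; rewrite ger0_norm.
move=> /cvgrPdist_lt/(_ _ e0); apply: filterS => n.
have [y -> [_ yp]] := it n.
rewrite sub0r normrN ger0_norm ?mulr_ge0 ?nrm_ge0 ?exprn_ge0 // => ?.
by exists y => //; apply: le_lt_trans yp _.
Qed.

Variable rho : R.
Hypothesis rho0 : 0 < rho.
Hypothesis fp : contracts_on f p kappa [set z | nrm (z - p) < rho].

Lemma fixed_point : f (finpt p) = finpt p.
Proof.
have [|y -> [_ yp]] := fp (z := p); first by rewrite /= subrr nrm0.
congr finpt; apply/eqP; rewrite -subr_eq0 -nrm_eq0 eq_le nrm_ge0 andbT.
by apply: le_trans yp _; rewrite subrr nrm0 mulr0.
Qed.

Lemma rat_eval_continuous z y (e : R) : f (finpt z) = finpt y -> 0 < e ->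
  exists2 d : R, 0 < d & forall x, nrm (x - z) < d ->
    exists2 w, f (finpt x) = finpt w & nrm (w - y) < e.
Proof.
move=> /rat_eval_finP[Qz Pz] e0.
pose c := nrm (rden f).[z] / 2.
have c0 : 0 < c by rewrite divr_gt0 // nrm_gt0.
have [d1 d10 hQ] := nrm_horner_continuous (rden f) z c0.
have [d2 d20 hg] := nrm_horner_continuous (rnum f - y *: rden f) z (mulr_gt0 e0 c0).
exists (Num.min d1 d2); first by rewrite lt_min d10.
move=> x; rewrite lt_min => /andP[/hQ Qx /hg].
have cQx : c < nrm (rden f).[x].
  have := ler_nrmD (rden f).[x] ((rden f).[z] - (rden f).[x]).
  by rewrite addrC subrK nrmB; move: Qx; rewrite /c; lra.
have Qx0 : (rden f).[x] != 0 by rewrite -nrm_gt0 (lt_trans c0).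
rewrite !(hornerD, hornerN, hornerZ) -Pz subrr subr0 => gx.
exists ((rnum f).[x] / (rden f).[x]); first by rewrite /= /rat_eval /= (negPf Qx0).
have -> : (rnum f).[x] / (rden f).[x] - y =
    ((rnum f).[x] - y * (rden f).[x]) / (rden f).[x] by rewrite mulrBl mulfK.
rewrite nrmM nrmV ltr_pdivrMr ?nrm_gt0 //.
by apply: lt_trans gx _; rewrite ltr_pM2l.
Qed.

(** An orbit converging to [p] enters the disc of radius [rho]; the basin is
    therefore the union of the iterated preimages of this disc. *)
Lemma basin_open z : basin f (finpt p) (finpt z) ->
  nbhs (finpt z) (basin f (finpt p)).
Proof.
move=> bz.
have : nbhs (finpt p) [set x | exists2 y, x = finpt y & nrm (y - p) < rho].
  by apply/nbhs_finptP; exists rho => // y yp; exists y.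
move=> /bz[n _ /(_ n (leqnn n))] /= [y ny yp].
elim: n z bz ny => [|n ih] z bz; rewrite ?iterSr.
  move=> [zy]; apply/nbhs_finptP; exists (rho - nrm (z - p)).
    by rewrite zy subr_gt0.
  move=> x xz; apply: (contracts_basin fp) => /=.
  by rewrite (le_lt_trans (ler_nrm_distD z _ _)) // -ltrBrDr.
have [w fw] : exists w, f (finpt z) = finpt w by apply/basin_finite/basin_f.
rewrite fw => /ih-/(_ _)/wrap[]; first by rewrite -fw; apply/basin_f.
move=> /nbhs_finptP[e e0 He].
have [d d0 hd] := rat_eval_continuous fw e0.
apply/nbhs_finptP; exists d => // x /hd[v fv /He].
by rewrite -fv => /basin_f.
Qed.

Lemma ball_component z : basin f (finpt p) (finpt z) -> exists2 e : R, 0 < e &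
  forall x, nrm (x - z) < e ->
    connected_component (basin f (finpt p)) (finpt z) (finpt x).
Proof.
move=> /basin_open/nbhs_finptP[e e0 He]; exists e => // x xz.
rewrite -[x](subrK z) addrC; apply: segment_component => t /andP[t0 t1].
apply: He; rewrite addrC addKr nrmM nrm_rc ger0_norm //.
by rewrite (le_lt_trans _ xz) // ler_piMl ?nrm_ge0.
Qed.

End Basin.

(** * Complete invariance of the immediate basin *)

Section Invariance.
Variables (R : realType) (f : ratfun R) (p : cplx R) (kappa rho : R).
Hypothesis f_oo : (size (rden f) < size (rnum f))%N.
Hypothesis k01 : 0 <= kappa < 1.
Hypothesis rho0 : 0 < rho.
Hypothesis fp : contracts_on f p kappa [set z | nrm (z - p) < rho].
Implicit Types (x y z w : sphere R).

Let Omega := basin f (finpt p).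
Let B := immediate_basin f (finpt p).

(** The image of the component [U] of [x] meets [B] in a set that is open in [B]
    ([rat_eval_open]) and closed in [B] ([rat_eval_closed]: when [f u], with [u]
    in [U], is close to a point [y] of [B], then [u] lies in a small disc around
    some [z] of the fibre of [y], so that [z] is in [U] too). It is nonempty and
    [B] is connected, so it is all of [B]. *)
Lemma component_onto x : Omega x -> B (f x) ->
  B `<=` f @` connected_component Omega x.
Proof.
move=> Ox Bfx; set U := connected_component Omega x.
have BO : B `<=` Omega by exact: connected_component_sub.
have UO : U `<=` Omega by exact: connected_component_sub.
have Uball (z : cplx R) : U (finpt z) -> exists2 e : R, 0 < e &
    forall y : cplx R, nrm (y - z) < e -> U (finpt y).
  move=> Uz; have [e e0 He] := ball_component f_oo k01 rho0 fp (UO _ Uz).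
  by exists e => // y /He; apply: connected_component_trans.
suff BfU : B `&` (f @` U) = B by rewrite -BfU => y [].
have cB : connected B by exact: component_connected.
apply: cB.
- by exists (f x); split => //; exists x => //; exact: connected_component_refl.
- exists (f @` U) => //; rewrite openE => _ [u Uu <-].
  have [a ua] := basin_finite f_oo (UO _ Uu).
  have [b fab] : exists b, f u = finpt b.
    exact/(basin_finite f_oo)/basin_f/UO.
  rewrite fab; rewrite ua in Uu fab.
  have [e e0 He] := Uball _ Uu.
  have [d d0 Hd] := rat_eval_open f_oo e0 fab.
  apply/nbhs_finptP; exists d => // y /Hd[x' /He Ux' fx'].
  by exists (finpt x').
- exists (closure (f @` U)); first exact: closed_closure.
  apply/seteqP; split=> y [By]; first by split => //; exact: subset_closure.
  move=> cy; split=> //.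
  have [b yb] := basin_finite f_oo (BO _ By); subst y.
  (* [e z] is the radius of a disc around [z] inside the component of [z] *)
  have /choice[e He] : forall z : cplx R, exists e : R, 0 < e /\
      (f (finpt z) = finpt b -> forall x : cplx R, nrm (x - z) < e ->
        connected_component Omega (finpt z) (finpt x)).
    move=> z; have [fz|fz] := pselect (f (finpt z) = finpt b); last by exists 1.
    have [|e e0 He] := @ball_component R f p f_oo kappa k01 rho rho0 fp z.
      by apply/basin_f; rewrite fz; exact: BO.
    by exists e; split.
  have e0 (z : cplx R) : 0 < e z by have [] := He z.
  have [d d0 Hd] := rat_eval_closed f_oo b e0.
  have [|y [[u Uu <-] /= [c fuc cb]]] :=
    cy [set w | exists2 c, w = finpt c & nrm (c - b) < d].
    by apply/nbhs_finptP; exists d => // c cb; exists c.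
  have [a ua] := basin_finite f_oo (UO _ Uu); subst u.
  have [z fz za] := Hd _ _ fuc cb.
  exists (finpt z) => //; apply: connected_component_trans Uu _.
  by apply: connected_component_sym; have [_ /(_ fz _ za)] := He z.
Qed.

Lemma fixed_in_immediate_basin : B (finpt p).
Proof.
apply: connected_component_refl; apply: (contracts_basin k01 fp).
by rewrite /= subrr nrm0.
Qed.

(** If [x] is in the basin and [f x] is in [B], the component of [x] contains a
    preimage of [w], which lies in [B], so [x] is in [B]. Pulling back along an
    orbit that has entered a disc around [p] shows that the whole basin is in
    [B]. *)
Lemma immediate_basin_eq w : B w -> (forall x, f x = w -> B x) -> B = Omega.
Proof.
move=> Bw fiber_w.
have back x : Omega x -> B (f x) -> B x.
  move=> Ox /(component_onto Ox)/(_ w Bw)[u xu fu].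
  have Bu := fiber_w u fu.
  apply: connected_component_trans Bu _.
  exact: connected_component_sym.
apply/seteqP; split; first exact: connected_component_sub.
move=> x Ox.
have [e e0 He] := ball_component f_oo k01 rho0 fp
  (connected_component_sub fixed_in_immediate_basin).
have : nbhs (finpt p) B by apply/nbhs_finptP; exists e.
move=> /Ox[n _ /(_ n (leqnn n))] /=.
elim: n => [//|n ih] /back Bn; apply: ih; apply: Bn.
exact/basin_iter.
Qed.

(** The difference quotients of [f] at [p] are at most [kappa] in modulus, and so
    is their limit. *)
Lemma attracting_of_contracts : attracting_fixed_point f (finpt p).
Proof.
have /andP[k0 k1] := k01; have ffp := fixed_point rho0 fp.
split=> //; rewrite /multiplier /= /derive1.
set q : cplx R -> cplx R := (fun h => _ *: _); set l := lim _.
suff lk : nrm l <= kappa.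
  by rewrite nrmE -rc1 ltcR; exact: le_lt_trans lk k1.
(* without a limit, [lim] would take its default value 0 *)
have [ql|/dvgP] := pselect (cvg (q @ 0^')); last first.
  by rewrite -/l => ->; rewrite nrm0.
rewrite leNgt; apply/negP => kl.
have lk0 : 0 < nrm l - kappa by rewrite subr_gt0.
have /nrm_cvgP/(_ _ lk0)/nbhs_nrmP[e e0 He] : q @ 0^' --> l by [].
pose d := Num.min e rho / 2.
have m0 : 0 < Num.min e rho by rewrite lt_min e0.
have d0 : 0 < d by rewrite divr_gt0.
have dm : d < Num.min e rho by rewrite ltr_pdivrMr // ltr_pMr // ltr1n.
have nd : nrm (rc d) = d by rewrite nrm_rc gtr0_norm.
have /He : nrm (rc d - 0) < e by rewrite subr0 nd (lt_le_trans dm) // ge_min lexx.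
have rd0 : rc d != 0 by rewrite rc_eq0 gt_eqF.
move=> /(_ rd0); apply/negP; rewrite -leNgt.
have [|y fy [_ yp]] := fp (z := rc d + p).
  by rewrite /= addrK nd (lt_le_trans dm) // ge_min lexx orbT.
have qk : nrm (q (rc d)) <= kappa.
  rewrite /q fy ffp /= [nrm _](nrmM (rc d)^-1) nrmV nd mulrC ler_pdivrMr //.
  by rewrite addrK nd in yp.
have := ler_nrmD (q (rc d)) (l - q (rc d)).
rewrite addrC subrK (nrmB l); move: qk; lra.
Qed.

End Invariance.

(** * Counting critical points *)

Lemma sum_mup_roots (K : fieldType) (rs : seq K) (c : K) : c != 0 ->
  \sum_(z <- undup rs) mup z (c *: \prod_(a <- rs) ('X - a%:P)) = size rs.
Proof.
move=> c0; have mupE z : mup z (c *: \prod_(a <- rs) ('X - a%:P)) = count_mem z rs.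
  rewrite -mul_polyC mupMr ?rootC //.
  elim: rs => [|a rs ih]; first by rewrite big_nil mupNroot // rootC oner_eq0.
  rewrite big_cons mupM ?polyXsubC_eq0 //; last first.
    by rewrite monic_neq0 // monic_prod_XsubC.
  by rewrite ih -['X - a%:P]expr1 mup_XsubCX /=; case: ifP => /eqP.
rewrite -[RHS](perm_size (perm_count_undup rs)) size_flatten /shape -map_comp.
rewrite sumnE big_map; apply: eq_bigr => z _.
by rewrite mupE /= size_nseq.
Qed.

Definition wronskian (K : fieldType) (P Q : {poly K}) := P^`() * Q - P * Q^`().

(** Writing [P = g * ('X - z)^(n+1)] with [g z] nonzero, the Wronskian is
    [('X - z)^n] times a polynomial whose value at [z] is [(n+1) g(z) Q(z)];
    the factor [n+1] is where characteristic 0 enters. *)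
Lemma mup_wronskian (K : numFieldType) (P Q : {poly K}) z :
  P != 0 -> root P z -> ~~ root Q z -> mup z (wronskian P Q) = (mup z P).-1.
Proof.
move=> P0 Pz Qz.
have := mup_geq z (mup z P) P0; rewrite leqnn => /esym.
have := mup_geq z (mup z P).+1 P0; rewrite ltnn => /esym/negbT.
have : (0 < mup z P)%N by rewrite -XsubC_dvd // dvdp_XsubCl.
case: (mup z P) => // n _ /= nd /dvdpP[g PE].
have gz : ~~ root g z.
  apply: contra nd; rewrite -dvdp_XsubCl => /dvdpP[h hE].
  by apply/dvdpP; exists h; rewrite PE hE -mulrA -exprS.
have WE : wronskian P Q = (g *+ n.+1 * Q + ('X - z%:P) * (g^`() * Q - g * Q^`()))
                          * ('X - z%:P) ^+ n.
  rewrite /wronskian PE derivM deriv_exp derivXsubC /= mul1r exprS.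
  ring.
rewrite WE mupMr ?mup_XsubCX ?eqxx //.
rewrite /root !(hornerXsubC, hornerD, hornerM, hornerMn) subrr mul0r addr0.
by rewrite mulf_neq0 // mulrn_eq0 negb_or gz.
Qed.

Section Critical.
Variables (R : realType) (f : ratfun R) (B : set (sphere R)).
Hypothesis f_oo : (size (rden f) < size (rnum f))%N.
Hypothesis Boo : ~ B infty.
Hypothesis Bpole : forall z, B (finpt z) -> ~~ root (rden f) z.

(** Replacing the numerator [P] by [P - c Q] does not change the Wronskian;
    with [c = f z], [mup_wronskian] identifies the multiplicity of [z] as a
    critical point with its multiplicity as a root of the Wronskian. The factor
    [V] collects the critical points outside [B]. *)
Lemma num_crit_eq (V T : {poly cplx R}) : T != 0 ->
  wronskian (rnum f) (rden f) = V * T ->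
  (forall z, B (finpt z) -> ~~ root V z) ->
  (forall z, root T z -> B (finpt z)) ->
  num_crit f B = (size T).-1.
Proof.
move=> T0 WE BV TB.
have crit z : B (finpt z) -> crit_mult f (finpt z) = mup z T.
  move=> Bz; have Qz := Bpole Bz.
  rewrite /crit_mult /local_degree /=.
  have -> : f (finpt z) = finpt ((rnum f).[z] / (rden f).[z]).
    by rewrite /= /rat_eval /= ifN.
  set c := _ / _; rewrite -(mup_wronskian _ _ Qz).
  - have -> : wronskian (rnum f - c *: rden f) (rden f) = V * T.
      rewrite -WE /wronskian derivB derivZ -!mul_polyC; ring.
    by rewrite mupMr // BV.
  - rewrite -size_poly_gt0 size_polyDl ?size_polyN; first exact: leq_ltn_trans f_oo.
    exact: leq_ltn_trans (size_scale_leq _ _) f_oo.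
  - by rewrite /root !(hornerD, hornerN, hornerZ) divfK // subrr.
have [rs TE] := closed_field_poly_normal T.
have lT : lead_coef T != 0 by rewrite lead_coef_eq0.
have rsP z : (z \in rs) = root T z by rewrite TE rootZ // root_prod_XsubC.
rewrite /num_crit (fsbigE (map (@finpt R) (undup rs))).
- rewrite big_map [in RHS]TE size_scale // size_prod_XsubC /= -(sum_mup_roots rs lT) -TE.
  rewrite big_seq_cond [RHS]big_seq; apply: eq_big => z.
    rewrite mem_undup; case zr: (z \in rs) => //=; apply/mem_set/TB.
    by rewrite -rsP.
  by move=> /andP[_ /set_mem/crit].
- by rewrite map_inj_uniq ?undup_uniq // => x y [].
- by move=> _ /mapP[z + ->]; rewrite mem_undup rsP; exact: TB.
- move=> [z|] // Bz; rewrite crit //.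
  rewrite (mem_map (f := @finpt R)); last by move=> x y [].
  by rewrite mem_undup rsP; exact: mupNroot.
Qed.

End Critical.

(** * Escaping polynomials *)

(** What remains to be checked on a concrete map: a contracting disc around [p],
    one point [w] of the immediate basin with its whole fibre in it, a pole [a]
    encircled by points of the basin, and the location of the critical
    points. *)
Lemma basin_criterion (R : realType) (f : ratfun R) (p a w : cplx R)
    (kappa rho r0 : R) (V T : {poly cplx R}) :
  (size (rden f) < size (rnum f))%N ->
  0 <= kappa < 1 -> 0 < rho ->
  contracts_on f p kappa [set z | nrm (z - p) < rho] ->
  immediate_basin f (finpt p) (finpt w) ->
  (forall z, f (finpt z) = finpt w -> immediate_basin f (finpt p) (finpt z)) ->
  root (rden f) a -> 0 < r0 ->
  (forall z, nrm (z - a) = r0 -> basin f (finpt p) (finpt z)) ->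
  T != 0 -> wronskian (rnum f) (rden f) = V * T ->
  (forall z, root V z -> ~ basin f (finpt p) (finpt z)) ->
  (forall z, root T z -> basin f (finpt p) (finpt z)) ->
  [/\ attracting_fixed_point f (finpt p),
      completely_invariant f (immediate_basin f (finpt p)),
      ~ simply_connected R (immediate_basin f (finpt p)) &
      num_crit f (immediate_basin f (finpt p)) = (size T).-1].
Proof.
move=> f_oo k01 rho0 fp Bw fiber_w Qa r00 circ T0 WE VB TB.
have -> : immediate_basin f (finpt p) = basin f (finpt p).
  apply: (immediate_basin_eq f_oo k01 rho0 fp Bw) => -[z|]; first exact: fiber_w.
  by have := rat_eval_infty f_oo; rewrite /infty => ->.
have Boo := @infty_notin_basin R f p f_oo.
split.
- exact: attracting_of_contracts k01 rho0 fp.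
- by apply/seteqP; split=> x /basin_f.
- apply: (circle_not_simply_connected r00 Boo) circ.
  by apply: pole_notin_basin => //; exact/rootP.
- have Bpole z : basin f (finpt p) (finpt z) -> ~~ root (rden f) z.
    by move=> Bz; apply/negP => /rootP Qz; exact: (pole_notin_basin f_oo Qz Bz).
  have BV z : basin f (finpt p) (finpt z) -> ~~ root V z.
    by move=> Bz; apply/negP => Vz; exact: (VB z Vz Bz).
  exact: (num_crit_eq f_oo Boo Bpole T0 WE BV TB).
Qed.

Lemma nrmX_le (R : realType) (z : cplx R) n :
  (0 < n)%N -> nrm z <= 1 -> nrm (z ^+ n) <= nrm z.
Proof.
case: n => // n _ z1; rewrite exprS nrmM ler_piMr ?nrm_ge0 // nrmX.
by rewrite exprn_ile1 ?nrm_ge0.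
Qed.

(** The map [beta z^d / (1 - z^j)] is conjugate, by inversion of the coordinate,
    to the polynomial [(w^d - w^(d-j)) / beta], with 0 in the role of infinity;
    in particular, the only preimage of 0 is 0. Besides 0, of multiplicity
    [d - 1], the finite critical points are the [j] solutions of
    [z^j = d / (d - j)]; when [beta] is small they are sent near 0, that is, the
    nonzero critical points of the polynomial escape. *)
Section Escaping.
Variables (R : realType) (d j : nat).
Hypotheses (j0 : (0 < j)%N) (jd : (j < d)%N).
Implicit Types z : cplx R.

(* small enough to bring both the circle of radius 3 around 1 and the critical
   points, which have modulus at most [d], close to 0 *)
Let beta : R := (4 * 4 ^+ d * d%:R ^+ d.+1)^-1.
Let P : {poly cplx R} := rc beta *: 'X^d.
Let Q : {poly cplx R} := 1 - 'X^j.

Let d0 : 1 <= d%:R :> R.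
Proof. by rewrite ler1n (leq_trans j0) // ltnW. Qed.

Let beta_gt0 : 0 < beta.
Proof. by rewrite invr_gt0 !mulr_gt0 ?exprn_gt0 // (lt_le_trans ltr01). Qed.

Let beta_le a : 0 <= a -> a <= 4 ^+ d * d%:R ^+ d.+1 -> beta * a <= 1 / 4.
Proof.
move=> a0 ale; have D : 0 < 4 ^+ d * d%:R ^+ d.+1 :> R.
  by rewrite mulr_gt0 ?exprn_gt0 // (lt_le_trans ltr01).
rewrite /beta -mulrA invfM -mulrA mul1r ler_piMr ?invr_ge0 //.
by rewrite ler_pdivrMl // mulr1.
Qed.

Let rc_beta_neq0 : rc beta != 0.
Proof. by rewrite rc_eq0 gt_eqF. Qed.

Let size_P : size P = d.+1.
Proof. by rewrite size_scale // size_polyXn. Qed.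

Let size_Q : size Q = j.+1.
Proof.
by rewrite /Q addrC size_polyDl size_polyN size_polyXn // size_poly1.
Qed.

Let PQ_coprime : coprimep P Q.
Proof.
rewrite coprimepZl // coprimep_expl // -['X]subr0 -polyC0 coprimep_sym.
by rewrite coprimep_XsubC /root /Q !hornerE expr0n gtn_eqF //= subr0 oner_eq0.
Qed.

Let f := RatFun PQ_coprime.

Let f_oo : (size (rden f) < size (rnum f))%N.
Proof. by rewrite /= size_P size_Q ltnS. Qed.

Let fE z : 1 - z ^+ j != 0 -> f (finpt z) = finpt (rc beta * z ^+ d / (1 - z ^+ j)).
Proof.
move=> q0; rewrite /= /rat_eval /= /P /Q !(hornerD, hornerN, hornerZ, hornerXn, hornerC).
by rewrite ifN.
Qed.

Let f0 : contracts_on f 0 (1 / 2) [set z | nrm (z - 0) < 1 / 2].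
Proof.
move=> z /=; rewrite subr0 => z2.
have zj : nrm (z ^+ j) <= nrm z.
  by apply: nrmX_le => //; lra.
have q2 : 1 / 2 <= nrm (1 - z ^+ j).
  by have := ler_nrmBr 1 (z ^+ j); rewrite nrm1; lra.
have q0 : 1 - z ^+ j != 0 by rewrite -nrm_gt0; lra.
rewrite fE //; eexists; first reflexivity.
have zd : nrm (z ^+ d) <= nrm z.
  by apply: nrmX_le; [exact: leq_trans jd|lra].
suff H : nrm (rc beta * z ^+ d / (1 - z ^+ j)) <= 1 / 2 * nrm z.
  by rewrite /= !subr0; split=> //; have := nrm_ge0 z; lra.
have b4 : beta <= 1 / 4.
  rewrite -(mulr1 beta); apply: beta_le => //.
  by rewrite -[leLHS]mulr1 ler_pM // exprn_ege1 // ler1n.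
rewrite nrmM nrmV ler_pdivrMr ?nrm_gt0 // nrmM nrm_rc gtr0_norm //.
apply: (@le_trans _ _ (1 / 4 * nrm z)); first by rewrite ler_pM ?nrm_ge0 // ltW.
have := nrm_ge0 z; nra.
Qed.

Let f_escape z y : f (finpt z) = finpt y -> nrm y < 1 / 2 ->
  basin f (finpt 0) (finpt z).
Proof.
move=> fz y2; apply/basin_f; rewrite fz.
by apply: (contracts_basin _ f0); rewrite /= ?subr0 //; lra.
Qed.

Let T : {poly cplx R} := rc beta *: 'X^(d.-1) * (d%:R%:P - (d - j)%:R *: 'X^j).

Let wronskianE : wronskian P Q = 1 * T.
Proof.
rewrite mul1r /T /wronskian /P /Q derivZ derivB !derivXn derivC sub0r.
have -> : 'X^d = 'X^(d.-1) * 'X :> {poly cplx R}.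
  by rewrite -exprSr prednK // (leq_trans j0) // ltnW.
have -> : 'X^j = 'X^(j.-1) * 'X :> {poly cplx R} by rewrite -exprSr prednK.
have natE n : (n%:R : cplx R)%:P = n%:R by exact: rmorph_nat.
rewrite (natrB _ (ltnW jd)) -(mulr_natr 'X^(d.-1) d) -(mulr_natr 'X^(j.-1) j) -!mul_polyC 
  polyCB !natE.
ring.
Qed.

Let size_T : size T = (d + j)%N.
Proof.
have s0 : (d - j)%:R != 0 :> cplx R by rewrite pnatr_eq0 subn_eq0 -ltnNge.
have sz : size (d%:R%:P - (d - j)%:R *: 'X^j : {poly cplx R}) = j.+1.
  rewrite addrC size_polyDl size_polyN size_scale // size_polyXn //.
  by rewrite size_polyC ltnS; case: (_ != 0).
rewrite /T -scalerAl size_scale // mulrC size_mulXn -?size_poly_gt0 sz //.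
by rewrite addnS -addSn prednK // (leq_trans j0) // ltnW.
Qed.

Let T_neq0 : T != 0.
Proof. by rewrite -size_poly_gt0 size_T addn_gt0 j0 orbT. Qed.

Lemma escaping_realization : exists (f : ratfun R) (p : sphere R),
    [/\ ratdeg f = d,
        attracting_fixed_point f p,
        completely_invariant f (immediate_basin f p),
        ~ simply_connected R (immediate_basin f p) &
        num_crit f (immediate_basin f p) = (d + j).-1].
Proof.
exists f, (finpt 0).
have half01 : 0 <= (1 / 2 : R) < 1.
  by apply/andP; split; lra.
have half0 : (0 : R) < 1 / 2 by lra.
have [] := @basin_criterion R f 0 1 0 (1 / 2) (1 / 2) 3 1 T f_oo half01 half0 f0 _ _ _ _
   _ T_neq0 wronskianE _ _.
- exact: fixed_in_immediate_basin f0.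
- move=> z /rat_eval_finP[_ /=]; rewrite mul0r hornerZ hornerXn.
  move=> /eqP; rewrite mulf_eq0 (negPf rc_beta_neq0) /= expf_eq0 => /andP[_ /eqP ->].
  exact: fixed_in_immediate_basin f0.
- by rewrite /root /= /Q !(hornerD, hornerN, hornerXn, hornerC) expr1n subrr.
- lra.
- move=> z z3.
  have z2 : 2 <= nrm z.
    by have := ler_nrmBD z 1; rewrite nrm1 z3; lra.
  have z4 : nrm z <= 4.
    by have := ler_nrmD (z - 1) 1; rewrite subrK nrm1 z3; lra.
  have zj : 2 <= nrm (z ^+ j).
    rewrite nrmX -(expr1 2) (le_trans (y := 2 ^+ j)) //.
      by rewrite ler_weXn2l //; lra.
    by rewrite lerXn2r ?nnegrE ?nrm_ge0 //; lra.
  have q1 : 1 <= nrm (1 - z ^+ j).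
    by rewrite nrmB; have := ler_nrmBr (z ^+ j) 1; rewrite nrm1; lra.
  have q0 : 1 - z ^+ j != 0 by rewrite -nrm_gt0; lra.
  apply: (f_escape (fE q0)).
  rewrite nrmM nrmV ltr_pdivrMr ?nrm_gt0 // nrmM nrm_rc gtr0_norm //.
  have : beta * nrm (z ^+ d) <= 1 / 4; last by lra.
  apply: beta_le; first exact: nrm_ge0.
  rewrite nrmX -[leLHS]mulr1 ler_pM ?exprn_ge0 ?nrm_ge0 ?exprn_ege1 //.
  by rewrite lerXn2r ?nnegrE ?nrm_ge0 //; lra.
- by move=> z; rewrite /root hornerC oner_eq0.
- move=> z; rewrite /root /T !(hornerM, hornerZ, hornerXn, hornerD, hornerN, hornerC).
  rewrite mulf_eq0 mulf_eq0 (negPf rc_beta_neq0) /= expf_eq0 => /orP[/andP[_ /eqP ->]|].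
    by apply: (contracts_basin half01 f0); rewrite /= subrr nrm0; lra.
  rewrite subr_eq0 => /eqP dz.
  have s1 : 1 <= (d - j)%:R :> R by rewrite ler1n subn_gt0.
  have sd : (d - j)%:R <= d%:R :> R by rewrite ler_nat leq_subr.
  have tE : d%:R = (d - j)%:R * nrm z ^+ j :> R.
    by have := congr1 (@nrm R) dz; rewrite nrmM nrmX !nrm_nat.
  have qE : (d - j)%:R * nrm (1 - z ^+ j) = j%:R :> R.
    rewrite -(nrm_nat _ (d - j)) -nrmM mulrBr -dz mulr1 nrmB -natrB ?leq_subr //.
    by rewrite nrm_nat subKn // ltnW.
  have j1 : 1 <= j%:R :> R by rewrite ler1n.
  have q0 : 0 < nrm (1 - z ^+ j).
    rewrite lt_neqAle nrm_ge0 andbT eq_sym; apply/eqP => q0.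
    by move: qE; rewrite q0; lra.
  have qd : 1 <= d%:R * nrm (1 - z ^+ j) by nra.
  have zd : nrm z <= d%:R.
    rewrite leNgt; apply/negP => dz'.
    have : nrm z <= nrm z ^+ j.
      by rewrite -[leLHS]expr1 ler_weXn2l //; have := d0; lra.
    have := d0; nra.
  have q0' : 1 - z ^+ j != 0 by rewrite -nrm_gt0.
  apply: (f_escape (fE q0')).
  rewrite nrmM nrmV ltr_pdivrMr // nrmM nrm_rc gtr0_norm //.
  have : beta * (nrm (z ^+ d) * d%:R) <= 1 / 4.
    apply: beta_le; first by rewrite mulr_ge0 ?nrm_ge0 // ler0n.
    rewrite nrmX -[leLHS]mul1r ler_pM ?mulr_ge0 ?exprn_ge0 ?nrm_ge0 ?exprn_ege1 ?ler1n //.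
    rewrite exprSr ler_wpM2r ?ler0n // lerXn2r ?nnegrE ?nrm_ge0 ?ler0n //.
  rewrite -(ltr_pM2l (lt_le_trans ltr01 d0)); move: qd; lra.
- move=> h1 h2 h3 h4; split=> //; last by rewrite -size_T.
  by rewrite /ratdeg /= size_P size_Q (maxn_idPl _) // ltnS ltnW.
Qed.

End Escaping.

(** * Maps with a bubble *)

Lemma nrm_subX_le (R : realType) (B : R) (z w : cplx R) n : 1 <= B ->
  nrm z <= B -> nrm w <= B ->
  nrm (z ^+ n - w ^+ n) <= n%:R * B ^+ n * nrm (z - w).
Proof.
move=> B1 zB wB; have B0 : 0 <= B by apply: le_trans B1; exact: ler01.
elim: n => [|n ih]; first by rewrite subrr nrm0 !mul0r.
have -> : z ^+ n.+1 - w ^+ n.+1 = z * (z ^+ n - w ^+ n) + (z - w) * w ^+ n.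
  by rewrite !exprS; ring.
apply: le_trans (ler_nrmD _ _) _; rewrite !nrmM nrmX.
have wn : nrm w ^+ n <= B ^+ n by rewrite lerXn2r ?nnegrE ?nrm_ge0.
have h1 : nrm z * nrm (z ^+ n - w ^+ n) <= B * (n%:R * B ^+ n * nrm (z - w)).
  by rewrite ler_pM ?nrm_ge0.
have h2 : nrm (z - w) * nrm w ^+ n <= nrm (z - w) * (B * B ^+ n).
  rewrite ler_wpM2l ?nrm_ge0 // (le_trans wn) // ler_peMl ?exprn_ge0 //.
apply: le_trans (lerD h1 h2) _; rewrite -natr1 exprS le_eqVlt; apply/orP; left.
by apply/eqP; ring.
Qed.

Lemma Re_le_nrm (R : realType) (z : cplx R) : `|complex.Re z| <= nrm z.
Proof.
rewrite -(ler_pXn2r (ltn0Sn 1)) ?nnegrE ?nrm_ge0 // nrm_sqr real_normK ?num_real //.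
by rewrite lerDl sqr_ge0.
Qed.

Lemma Im_le_nrm (R : realType) (z : cplx R) : `|complex.Im z| <= nrm z.
Proof.
rewrite -(ler_pXn2r (ltn0Sn 1)) ?nnegrE ?nrm_ge0 // nrm_sqr real_normK ?num_real //.
by rewrite lerDr sqr_ge0.
Qed.

Lemma le_nrm_coord (R : realType) (e a b : R) : 0 <= e -> e ^+ 2 <= a ^+ 2 + b ^+ 2 ->
  e <= nrm (Complex a b : cplx R).
Proof. by move=> e0 eab; rewrite -(ler_pXn2r (ltn0Sn 1)) ?nnegrE ?nrm_ge0 // nrm_sqr. Qed.

(** The map is [f z = 1 + eta z^m (1 + eps / (z-1)^r)]. For [eps = 0] it is close
    to the constant 1 and contracts towards a fixed point [p] near [1 + eta],
    with a critical point of multiplicity [m - 1] at 0 whose value is 1. The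
    singular term changes [f] only in a small disc around 1, where it adds [r] to
    the degree and sends 1 to infinity. So 0 goes to 1, then to infinity, and
    stays there, whereas the [r + 1] critical points created near 1, other than
    the pole 1 itself, belong to the basin of [p].

    The parameters are chosen in terms of the fixed point [p = 1 + t]. The two
    radii around 1 satisfy [delta << delta1 << t]: on a bounded region away from
    0, [f] maps the points outside the disc of radius [delta] to points outside
    the disc of radius [delta1], where the derivative of the singular term is
    negligible. *)
Section Bubble.
Variables (R : realType) (m r : nat).
Hypotheses (m0 : (0 < m)%N) (r0 : (0 < r)%N).
Implicit Types z : cplx R.

(* [t] absorbs the size of [z^m] on the disc of radius 6, which contains [core] *)
Let t : R := (3 * 6 ^+ m)^-1.
Let delta1 : R := t / 4 ^+ m.+1.
Let delta : R := delta1 ^+ 2 / (8 * (m + r)%:R).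
Let eps : R := delta ^+ r / 2.
Let sigma : R := (1 + t) ^+ m * (1 + eps / t ^+ r).
Let eta : R := t / sigma.
Let p : cplx R := rc (1 + t).

Let t_gt0 : 0 < t.
Proof. by rewrite invr_gt0 mulr_gt0 // exprn_gt0. Qed.

Let t6 : t * 6 ^+ m = 1 / 3.
Proof. by rewrite /t; field; rewrite expf_neq0 // pnatr_eq0. Qed.

Let m_ge1 : 1 <= m%:R :> R. Proof. by rewrite ler1n. Qed.
Let r_ge1 : 1 <= r%:R :> R. Proof. by rewrite ler1n. Qed.

Let t_2m_m : t * (2 ^+ m * m%:R) <= 1 / 9.
Proof.
have m3 : 3 * m%:R <= 3 ^+ m :> R.
  rewrite -natrX -natrM ler_nat; case: (m) m0 => // n _.
  by rewrite expnS leq_mul2l /= ltn_expl.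
have E : t * (2 ^+ m * 3 ^+ m) = 1 / 3.
  by rewrite -t6 -exprMn -natrM.
have : t * (2 ^+ m * (3 * m%:R)) <= 1 / 3.
  by rewrite -E !ler_wpM2l ?exprn_ge0 // ltW.
lra.
Qed.

Let t_2m : t * 2 ^+ m <= 1 / 9.
Proof.
apply: le_trans t_2m_m; rewrite ler_wpM2l ?(ltW t_gt0) // ler_peMr ?exprn_ge0 //.
Qed.

Let t_le : t <= 1 / 18.
Proof.
have : t * 2 <= t * 2 ^+ m.
  by rewrite ler_wpM2l ?(ltW t_gt0) // -[leLHS]expr1 ler_weXn2l // ler1n.
by move: t_2m; lra.
Qed.

Let delta1_gt0 : 0 < delta1.
Proof. by rewrite divr_gt0 ?exprn_gt0. Qed.

Let delta1_le : delta1 <= t / 16.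
Proof.
rewrite ler_pM2l // lef_pV2 ?posrE ?exprn_gt0 //.
rewrite (_ : 16 = 4 ^+ 2) ?ler_weXn2l ?ler1n //; lra.
Qed.

Let mr2 : 2 <= (m + r)%:R :> R.
Proof. by rewrite natrD; move: m_ge1 r_ge1; lra. Qed.

Let delta_gt0 : 0 < delta.
Proof. by rewrite divr_gt0 ?exprn_gt0 // mulr_gt0 //; move: mr2; lra. Qed.

Let delta_mr : delta * (8 * (m + r)%:R) = delta1 ^+ 2.
Proof. by rewrite /delta divfK // gt_eqF // mulr_gt0 //; move: mr2; lra. Qed.

Let delta_le : delta <= delta1 / 16.
Proof.
have d1t : delta1 <= 1 by move: delta1_le t_le; lra.
have d11 : delta1 ^+ 2 <= delta1 by rewrite expr2 ler_piMr // ltW.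
have := delta_mr; have := mr2; have := delta_gt0; nra.
Qed.

Let eps_gt0 : 0 < eps.
Proof. by rewrite divr_gt0 // exprn_gt0. Qed.

(* so that [|u z| <= 1 / 2] when [|z - 1| >= delta] *)
Let delta_r : delta ^+ r = 2 * eps.
Proof. by rewrite /eps; field. Qed.

Let eps_r : eps * r%:R <= delta1 ^+ r * delta1 ^+ r.
Proof.
rewrite -exprMn -expr2 -delta_mr exprMn delta_r; set X := _ ^+ r.
have X0 : 0 <= X by exact: exprn_ge0.
suff rX : r%:R <= X.
  have : eps * r%:R <= eps * X by rewrite ler_wpM2l // ltW.
  have : 0 <= eps * X by rewrite mulr_ge0 // ltW.
  lra.
apply: (@le_trans _ _ (8 * (m + r)%:R)).
  by rewrite natrD; move: m_ge1 r_ge1; lra.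
by rewrite -[leLHS]expr1 ler_weXn2l //; move: mr2; lra.
Qed.

Let eps_t : eps / t ^+ r <= 1 / 32.
Proof.
rewrite ler_pdivrMr ?exprn_gt0 //.
have : delta ^+ r <= (t / 16) ^+ r.
  have dt : delta <= t / 16.
    by have := delta_le; have := delta1_le; have := delta1_gt0; have := t_gt0; lra.
  have t16 : 0 <= t / 16 by rewrite divr_ge0 // ltW.
  by rewrite lerXn2r // ?nnegrE // ltW.
rewrite delta_r exprMn.
have : t ^+ r * 16^-1 ^+ r <= t ^+ r * 16^-1.
  rewrite ler_wpM2l ?exprn_ge0 ?(ltW t_gt0) // -[leRHS]expr1.
  by rewrite ler_wiXn2l //; lra.
lra.
Qed.

Let p_m : (1 + t) ^+ m <= 1 + 1 / 9.
Proof.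
have nt : nrm p = 1 + t by rewrite nrm_rc ger0_norm // addr_ge0 // ltW.
have n1 : nrm (1 : cplx R) <= 2 by rewrite nrm1; lra.
have np : nrm p <= 2 by rewrite nt; move: t_le; lra.
have := nrm_subX_le m (ler1n R 2) np n1.
have := ler_nrmBr (p ^+ m) (1 ^+ m).
rewrite !nrmX nt expr1n nrm1 expr1n.
have -> : p - 1 = rc t by rewrite /p rcD rc1 addrC addKr.
rewrite nrm_rc ger0_norm ?(ltW t_gt0) //.
by have := t_2m_m; lra.
Qed.

Let p_ge1 : 1 <= (1 + t) ^+ m.
Proof. by rewrite exprn_ege1 // lerDl ltW. Qed.

Let sigma_ge1 : 1 <= sigma.
Proof.
have : 0 < eps / t ^+ r by rewrite divr_gt0 // exprn_gt0.
by rewrite /sigma; have := p_ge1; nra.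
Qed.

Let sigma_le : sigma <= 6 / 5.
Proof.
have : 0 < eps / t ^+ r by rewrite divr_gt0 // exprn_gt0.
by rewrite /sigma; have := p_ge1; have := p_m; have := eps_t; nra.
Qed.

Let eta_sigma : eta * sigma = t.
Proof. by rewrite /eta divfK // gt_eqF // (lt_le_trans ltr01). Qed.

Let eta_gt0 : 0 < eta.
Proof. by rewrite divr_gt0 // (lt_le_trans ltr01). Qed.

Let eta_le : eta <= t.
Proof. have := eta_sigma; have := sigma_ge1; have := eta_gt0; nra. Qed.

Let eta_ge : t / 2 <= eta.
Proof. have := eta_sigma; have := sigma_le; have := eta_gt0; nra. Qed.

Let X1 : {poly cplx R} := 'X - 1%:P.
Let Q : {poly cplx R} := X1 ^+ r.
Let P : {poly cplx R} := Q + rc eta *: ('X^m * (Q + (rc eps)%:P)).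

Let eta_neq0 : rc eta != 0.
Proof. by rewrite rc_eq0 gt_eqF. Qed.

Let size_Q : size Q = r.+1.
Proof. by rewrite size_exp_XsubC. Qed.

Let size_Qeps : size (Q + (rc eps)%:P) = r.+1.
Proof.
rewrite size_polyDl // size_Q ltnS.
by apply: leq_trans (size_polyC_leq1 _) _.
Qed.

Let size_P : size P = (m + r).+1.
Proof.
have sz : size (rc eta *: ('X^m * (Q + (rc eps)%:P))) = (m + r).+1.
  by rewrite size_scale // mulrC size_mulXn -?size_poly_gt0 size_Qeps // addnS.
by rewrite /P addrC size_polyDl // sz size_Q ltnS -{1}(add0n r) ltn_add2r.
Qed.

Let P1 : P.[1] = rc eta * rc eps.
Proof.
rewrite /P /Q /X1 !(hornerD, hornerZ, hornerM, hornerXn, horner_exp, hornerC, hornerN, hornerX).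
by rewrite subrr expr0n gtn_eqF //= expr1n !add0r mul1r.
Qed.

Let PQ_coprime : coprimep P Q.
Proof.
rewrite coprimep_expr // coprimep_XsubC /root P1.
by rewrite mulf_neq0 // rc_eq0 gt_eqF.
Qed.

Let f := RatFun PQ_coprime.

Let f_oo : (size (rden f) < size (rnum f))%N.
Proof. by rewrite /= size_P size_Q ltnS -{1}(add0n r) ltn_add2r. Qed.

(* relative size of the singular term *)
Let u z : cplx R := rc eps / (z - 1) ^+ r.

Let fE z : z != 1 -> f (finpt z) = finpt (1 + rc eta * (z ^+ m * (1 + u z))).
Proof.
move=> z1; apply/rat_eval_finP; rewrite /= /P /Q /X1.
rewrite !(hornerD, hornerZ, hornerM, hornerXn, horner_exp, hornerC, hornerN, hornerX).
have z0 : (z - 1) ^+ r != 0 by rewrite expf_neq0 // subr_eq0.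
split=> //; rewrite /u; move: (_ ^+ r) z0 => X X0.
by field.
Qed.

Let u_le z (e : R) : 0 < e -> e <= nrm (z - 1) -> nrm (u z) <= eps / e ^+ r.
Proof.
move=> e0 ez; rewrite nrmM nrmV nrm_rc nrmX gtr0_norm // ler_pM2l //.
have zp : 0 < nrm (z - 1) by exact: lt_le_trans ez.
by rewrite lef_pV2 ?posrE ?exprn_gt0 // lerXn2r ?nnegrE ?nrm_ge0 // ltW.
Qed.

Let u_half z : delta <= nrm (z - 1) -> nrm (u z) <= 1 / 2.
Proof.
move=> /(u_le delta_gt0); rewrite delta_r.
by have -> : eps / (2 * eps) = 1 / 2 by field; rewrite gt_eqF.
Qed.

(* [core] is a connected part of the basin, large enough to contain the fibre of
   [p] and the critical points in question; its image lies in [collar], on which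
   [f] is a contraction *)
Let core z : Prop := [/\ `|complex.Re z| <= 3, `|complex.Im z| <= 3,
  1 / 2 <= nrm z & delta <= nrm (z - 1)].

Let collar z : Prop := delta1 <= nrm (z - 1) /\ nrm (z - 1) <= 1 / 2.

Let core_of_nrm z : nrm z <= 3 -> 1 / 2 <= nrm z -> delta <= nrm (z - 1) -> core z.
Proof.
by move=> z3; split => //; apply: le_trans z3; rewrite ?Re_le_nrm ?Im_le_nrm.
Qed.

Let collar_core z : collar z -> core z.
Proof.
move=> [z1 z2]; have h1 := ler_nrmBr 1 (1 - z); have h2 := ler_nrmD (z - 1) 1.
rewrite subrK nrm1 in h2; rewrite opprB addrCA subrr addr0 nrm1 nrmB in h1.
apply: core_of_nrm; try lra.
by have := delta_le; have := delta1_gt0; lra.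
Qed.

Let core_neq1 z : core z -> z != 1.
Proof. by move=> [_ _ _ zd]; rewrite -subr_eq0 -nrm_gt0 (lt_le_trans delta_gt0). Qed.

Let core_collar z : core z -> collar (1 + rc eta * (z ^+ m * (1 + u z))).
Proof.
move=> [zre zim z2 zd]; rewrite /collar addrC addKr !nrmM nrm_rc gtr0_norm // nrmX.
have z6 : nrm z <= 6.
  rewrite -(ler_pXn2r (ltn0Sn 1)) ?nnegrE ?nrm_ge0 // nrm_sqr.
  rewrite -[complex.Re z ^+ 2]real_normK ?num_real //.
  rewrite -[complex.Im z ^+ 2]real_normK ?num_real //.
  have := normr_ge0 (complex.Re z); have := normr_ge0 (complex.Im z); nra.
have uz := u_half zd.
have v1 : 1 / 2 <= nrm (1 + u z) by have := ler_nrmDr 1 (u z); rewrite nrm1; lra.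
have v2 : nrm (1 + u z) <= 3 / 2 by have := ler_nrmD 1 (u z); rewrite nrm1; lra.
split.
  have zm : 1 / 2 ^+ m <= nrm z ^+ m.
    have <- : (1 / 2) ^+ m = 1 / 2 ^+ m :> R by rewrite expr_div_n expr1n.
    by rewrite lerXn2r ?nnegrE ?nrm_ge0.
  have E : delta1 = (t / 2) * (1 / 2 ^+ m * (1 / 2)) * (1 / 2 ^+ m).
    rewrite /delta1 exprS (_ : 4 = 2 * 2 :> R); last by ring.
    rewrite exprMn; field; rewrite expf_neq0 // pnatr_eq0 //.
  have h : 0 < 1 / 2 ^+ m :> R by rewrite divr_gt0 // exprn_gt0.
  apply: (@le_trans _ _ (t / 2 * (1 / 2 ^+ m * (1 / 2)))).
    rewrite E ler_piMr ?mulr_ge0 ?(ltW t_gt0) ?(ltW h) //.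
    by rewrite mul1r invf_le1 ?exprn_gt0 // exprn_ege1 // ler1n.
  have tw := ltW t_gt0; have hw := ltW h.
  by rewrite ler_pM // ?mulr_ge0 // ler_pM //.
have zm : nrm z ^+ m <= 6 ^+ m by rewrite lerXn2r ?nnegrE ?nrm_ge0.
have : eta * (nrm z ^+ m * nrm (1 + u z)) <= t * (6 ^+ m * (3 / 2)).
  by rewrite ler_pM ?(ltW eta_gt0) ?mulr_ge0 ?exprn_ge0 ?nrm_ge0 // ler_pM ?exprn_ge0 ?nrm_ge0.
have -> // : t * (6 ^+ m * (3 / 2)) = 1 / 2 by have := t6; lra.
Qed.

Let p_collar : collar p.
Proof.
rewrite /collar /p rcD rc1 addrC addKr nrm_rc gtr0_norm //.
have := delta1_le; have := t_gt0; have := t_le; lra.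
Qed.

(* [eta] is defined as [t / sigma] for this equation to hold *)
Let p_fixed : p = 1 + rc eta * (p ^+ m * (1 + u p)).
Proof.
have -> : p ^+ m * (1 + u p) = rc sigma.
  rewrite /sigma rcM rcX -/p rcD rc1 /u /p rcD rc1 [1 + rc t]addrC addrK.
  by rewrite rcM rcV rcX.
by rewrite -rcM eta_sigma -rc1 -rcD.
Qed.

(** The difference [f z - p] splits into [z^m - p^m], which is Lipschitz with a
    constant compensated by [eta], and [u z - u p], which is Lipschitz on
    [collar] because [eps r <= delta1^(2r)]. *)
Let contraction z : collar z ->
  nrm (1 + rc eta * (z ^+ m * (1 + u z)) - p) <= 1 / 2 * nrm (z - p).
Proof.
move=> zr; have [pd1 p2] := p_collar; have [zd1 z2] := zr.
have [_ _ _ zd] := collar_core zr.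
rewrite {1}p_fixed.
have -> : 1 + rc eta * (z ^+ m * (1 + u z)) - (1 + rc eta * (p ^+ m * (1 + u p))) =
    rc eta * ((z ^+ m - p ^+ m) * (1 + u z) + p ^+ m * (u z - u p)) by ring.
rewrite nrmM nrm_rc gtr0_norm //.
have nle (x : cplx R) : nrm (x - 1) <= 1 / 2 -> nrm x <= 2.
  by have := ler_nrmD (x - 1) 1; rewrite subrK nrm1; lra.
have v2 : nrm (1 + u z) <= 3 / 2.
  by have := ler_nrmD 1 (u z); have := u_half zd; rewrite nrm1; lra.
have A1 : nrm ((z ^+ m - p ^+ m) * (1 + u z)) <=
          (m%:R * 2 ^+ m * nrm (z - p)) * (3 / 2).
  rewrite nrmM ler_pM ?nrm_ge0 //.
  by apply: nrm_subX_le; rewrite ?ler1n ?nle.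
have A2 : nrm (u z - u p) <= nrm (z - p).
  have z0 : (z - 1) ^+ r != 0.
    by rewrite expf_neq0 // -nrm_gt0; exact: lt_le_trans zd1.
  have p0 : (p - 1) ^+ r != 0.
    by rewrite expf_neq0 // -nrm_gt0; exact: lt_le_trans pd1.
  have -> : u z - u p = rc eps * ((p - 1) ^+ r - (z - 1) ^+ r) / ((z - 1) ^+ r * (p - 1) ^+ r).
    rewrite /u; move: ((z - 1) ^+ r) ((p - 1) ^+ r) z0 p0 => X Y X0 Y0.
    by field; rewrite Y0 X0.
  rewrite nrmM nrmV ler_pdivrMr; last by rewrite nrm_gt0 mulf_neq0.
  have E : nrm ((p - 1) ^+ r - (z - 1) ^+ r) <= r%:R * nrm (z - p).
    have -> : nrm (z - p) = nrm ((p - 1) - (z - 1)).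
      by rewrite nrmB; congr nrm; ring.
    rewrite -[r%:R]mulr1 -[X in _ * X * _](expr1n _ r).
    by apply: nrm_subX_le => //; lra.
  have D : delta1 ^+ r * delta1 ^+ r <= nrm ((z - 1) ^+ r * (p - 1) ^+ r).
    rewrite nrmM !nrmX ler_pM ?exprn_ge0 ?(ltW delta1_gt0) //;
    by rewrite lerXn2r ?nnegrE ?nrm_ge0 ?(ltW delta1_gt0).
  rewrite nrmM nrm_rc gtr0_norm //.
  apply: (@le_trans _ _ (eps * (r%:R * nrm (z - p)))).
    by rewrite ler_pM2l.
  rewrite mulrA mulrC ler_wpM2l ?nrm_ge0 // (le_trans eps_r) //.
have A3 : nrm (p ^+ m * (u z - u p)) <= 2 ^+ m * nrm (z - p).
  rewrite nrmM ler_pM ?nrm_ge0 // nrmX lerXn2r ?nnegrE ?nrm_ge0 //.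
  exact: nle.
apply: (@le_trans _ _ (t * ((m%:R * 2 ^+ m * nrm (z - p)) * (3 / 2) + 2 ^+ m * nrm (z - p)))).
  rewrite ler_pM ?(ltW eta_gt0) ?nrm_ge0 // (le_trans (ler_nrmD _ _)) // lerD //.
have n0 := nrm_ge0 (z - p).
have B1 : t * (2 ^+ m * m%:R) * nrm (z - p) <= 1 / 9 * nrm (z - p) by rewrite ler_wpM2r.
have B2 : t * 2 ^+ m * nrm (z - p) <= 1 / 9 * nrm (z - p) by rewrite ler_wpM2r.
lra.
Qed.

Let half01 : 0 <= (1 / 2 : R) < 1.
Proof. by apply/andP; split; lra. Qed.

Let t2_gt0 : 0 < t / 2. Proof. by rewrite divr_gt0. Qed.

Let contracts_collar : contracts_on f p (1 / 2) collar.
Proof.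
move=> z zr; have zc := collar_core zr.
by eexists; [exact: fE (core_neq1 zc)|split; [exact: core_collar|exact: contraction]].
Qed.

Let contracts_ball : contracts_on f p (1 / 2) [set z | nrm (z - p) < t / 2].
Proof.
move=> z /= zp; have zr : collar z.
  have p1 : nrm (p - 1) = t.
    by rewrite /p rcD rc1 addrC addKr nrm_rc gtr0_norm.
  have := ler_nrm_distD p z 1; have := ler_nrm_distD z p 1; rewrite p1 (nrmB p z).
  by have := delta1_le; have := t_le; split; lra.
have [y fy [_ yp]] := contracts_collar zr.
by exists y => //; split=> //=; have := nrm_ge0 (z - p); lra.
Qed.

Let core_basin z : core z -> basin f (finpt p) (finpt z).
Proof.
move=> zc; apply/basin_f; rewrite (fE (core_neq1 zc)).
exact: (contracts_basin half01 contracts_collar (core_collar zc)).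
Qed.

Let core_path (a b a' b' : R) :
  (forall s, 0 <= s <= 1 -> core (Complex (a + s * (a' - a)) (b + s * (b' - b)))) ->
  connected_component (basin f (finpt p)) (finpt (Complex a b)) (finpt (Complex a' b')).
Proof.
move=> H; have -> : (Complex a' b' : cplx R) =
    (Complex a b : cplx R) + (Complex (a' - a) (b' - b) : cplx R).
  by apply/eqP; rewrite eq_complex /=; apply/andP; split; apply/eqP; ring.
apply: segment_component => s s01; apply: core_basin.
have -> : (Complex a b : cplx R) + rc s * (Complex (a' - a) (b' - b) : cplx R) =
   Complex (a + s * (a' - a)) (b + s * (b' - b)).
  by rewrite /rc; apply/eqP; rewrite eq_complex /=; apply/andP; split; apply/eqP; ring.
exact: H.
Qed.

Let coreI (a b : R) : `|a| <= 3 -> `|b| <= 3 -> 1 / 4 <= a ^+ 2 + b ^+ 2 ->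
  delta ^+ 2 <= (a - 1) ^+ 2 + b ^+ 2 -> core (Complex a b).
Proof.
move=> a3 b3 ab2 abd; split => //.
  by apply: le_nrm_coord; lra.
have -> : (Complex a b : cplx R) - 1 = Complex (a - 1) b.
  by apply/eqP; rewrite eq_complex /= subr0 !eqxx.
by apply: le_nrm_coord => //; exact: ltW.
Qed.

Let core_sqr (a b : R) : core (Complex a b) ->
  1 / 4 <= a ^+ 2 + b ^+ 2 /\ delta ^+ 2 <= (a - 1) ^+ 2 + b ^+ 2.
Proof.
move=> [_ _ h1 h2]; split.
  have := nrm_sqr (Complex a b : cplx R); rewrite /= => <-.
  by have := h1; nra.
have := nrm_sqr (Complex (a - 1) b : cplx R); rewrite /= => <-.
have <- : (Complex a b : cplx R) - 1 = Complex (a - 1) b.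
  by apply/eqP; rewrite eq_complex /= subr0 !eqxx.
by rewrite lerXn2r ?nnegrE ?nrm_ge0 // ltW.
Qed.

(** Moving away from the real axis increases the distance to both 0 and 1. So
    every point of [core] is joined vertically to one of the lines of imaginary
    part 3 or -3, then along it to the line of real part 3, and so to 3. *)
Let core_component z : core z ->
  connected_component (basin f (finpt p)) (finpt z) (finpt (Complex 3 0)).
Proof.
case: z => a b /[dup] zc [/= a3 b3 _ _]; have [h1 h2] := core_sqr zc.
have dl1 : delta <= 1 / 16 by have := delta_le; have := delta1_le; have := t_le; lra.
have dls : delta ^+ 2 <= 1 by have := delta_gt0; nra.
move: a3 b3; rewrite !ler_norml => /andP[a3 a3'] /andP[b3 b3'].
pose c : R := if 0 <= b then 3 else -3.
have cb s : 0 <= s <= 1 -> b ^+ 2 <= (b + s * (c - b)) ^+ 2 /\ -3 <= b + s * (c - b) <= 3.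
  move=> /andP[s0 s1]; rewrite /c; case: (leP 0 b) => bs.
    have : 0 <= s * (3 - b) by rewrite mulr_ge0 // subr_ge0.
    have : s * (3 - b) <= 3 - b by rewrite ler_piMl // subr_ge0.
    by move: (s * _) => x; split; nra.
  have : 0 <= s * (b + 3) by rewrite mulr_ge0 //; lra.
  have : s * (b + 3) <= b + 3 by rewrite ler_piMl //; lra.
  have -> : s * (-3 - b) = - (s * (b + 3)) by ring.
  by move: (s * _) => x; split; nra.
have c9 : c ^+ 2 = 9 by rewrite /c; case: ifP => _; ring.
have c3 : `|c| <= 3 by rewrite /c; case: ifP => _; rewrite ?normrN ger0_norm.
apply: (@connected_component_trans _ _ (finpt (Complex a c))).
  apply: core_path => s s01; have [q1 q2] := cb s s01.
  have -> : a + s * (a - a) = a by ring.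
  by apply: coreI; rewrite ?ler_norml //; [apply/andP|lra|lra].
apply: (@connected_component_trans _ _ (finpt (Complex 3 c))).
  apply: core_path => s /andP[s0 s1].
  have -> : c + s * (c - c) = c by ring.
  have e1 : 0 <= s * (3 - a) by rewrite mulr_ge0 // subr_ge0.
  have e2 : s * (3 - a) <= 3 - a by rewrite ler_piMl // subr_ge0.
  apply: coreI; rewrite ?c9 //; first by rewrite ler_norml; apply/andP; split; lra.
  - by have := sqr_ge0 (a + s * (3 - a)); lra.
  - by have := sqr_ge0 (a + s * (3 - a) - 1); lra.
apply: core_path => s /andP[s0 s1].
have -> : 3 + s * (3 - 3) = 3 :> R by ring.
have s1' : 0 <= 1 - s by rewrite subr_ge0.
have -> : c + s * (0 - c) = (1 - s) * c by ring.
apply: coreI; rewrite ?normrM.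
- by rewrite ger0_norm.
- by rewrite (ger0_norm s1') -[leRHS]mul1r ler_pM //; lra.
- by have := sqr_ge0 ((1 - s) * c); lra.
- by have := sqr_ge0 ((1 - s) * c); lra.
Qed.

Let core_immediate z : core z -> immediate_basin f (finpt p) (finpt z).
Proof.
move=> zc; apply: connected_component_trans (core_component (collar_core p_collar)) _.
exact/connected_component_sym/core_component.
Qed.

Let factor_bounds z : delta <= nrm (z - 1) ->
  1 / 2 <= nrm (1 + u z) /\ nrm (1 + u z) <= 3 / 2.
Proof.
move=> /u_half uz; have := ler_nrmD 1 (u z); have := ler_nrmDr 1 (u z).
by rewrite nrm1; split; lra.
Qed.

(** On the fibre of [p], [z^m (1 + u z) = sigma] with [sigma] close to 1. When
    [|z - 1| < delta], the value of [z^m] is close to 1 and [|u z| > 1 / 2], so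
    this is impossible; elsewhere [1 + u z] has modulus between 1/2 and 3/2,
    which bounds [|z|]. *)
Let fiber_core z : f (finpt z) = finpt p -> core z.
Proof.
move=> /rat_eval_finP[/=]; rewrite /P /Q /X1.
rewrite !(hornerD, hornerZ, hornerM, hornerXn, horner_exp, hornerC, hornerN, hornerX).
set X := (z - 1) ^+ r => X0 fz.
have hz : z ^+ m * (X + rc eps) = rc sigma * X.
  apply: (mulfI eta_neq0); apply: (addrI X); rewrite fz /p rcD rc1 -eta_sigma rcM; ring.
have s5 : nrm (rc sigma - 1) <= 1 / 5.
  rewrite -rc1 -rcN -rcD nrm_rc ger0_norm ?subr_ge0 //; have := sigma_le; lra.
have zd : delta <= nrm (z - 1).
  rewrite leNgt; apply/negP => xd.
  have dl1 : delta <= t / 16.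
    by have := delta_le; have := delta1_le; have := t_gt0; have := delta1_gt0; lra.
  have z2 : nrm z <= 2.
    by have := ler_nrmD (z - 1) 1; rewrite subrK nrm1; have := t_le; lra.
  have n2 : nrm (1 : cplx R) <= 2 by rewrite nrm1; lra.
  have zm1 : nrm (z ^+ m - 1) <= 1 / 144.
    have := nrm_subX_le m (ler1n R 2) z2 n2; rewrite expr1n => h; apply: le_trans h _.
    apply: (@le_trans _ _ (2 ^+ m * m%:R * (t / 16))).
      rewrite (mulrC m%:R) ler_wpM2l ?mulr_ge0 ?exprn_ge0 //.
      by apply: ltW; exact: lt_le_trans dl1.
    by have := t_2m_m; lra.
  have Xe : nrm X <= 2 * eps.
    by rewrite -delta_r /X nrmX lerXn2r ?nnegrE ?nrm_ge0 // ltW.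
  have E : (rc sigma - z ^+ m) * X = rc eps * z ^+ m by rewrite mulrBl -hz; ring.
  have := congr1 (@nrm R) E; rewrite !nrmM nrm_rc gtr0_norm //.
  have sz : nrm (rc sigma - z ^+ m) <= 1 / 4.
    have := ler_nrm_distD 1 (rc sigma) (z ^+ m); rewrite (nrmB 1); lra.
  have zm : 1 / 2 < nrm (z ^+ m).
    by have := ler_nrmD (1 - z ^+ m) (z ^+ m); rewrite subrK nrm1 nrmB; lra.
  have : nrm (rc sigma - z ^+ m) * nrm X <= 1 / 4 * (2 * eps) by rewrite ler_pM ?nrm_ge0.
  have : eps * (1 / 2) < eps * nrm (z ^+ m) by rewrite ltr_pM2l.
  lra.
have [v1 v2] := factor_bounds zd.
have hs : nrm (z ^+ m) * nrm (1 + u z) = sigma.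
  rewrite -nrmM -[RHS]ger0_norm -?nrm_rc ?(le_trans ler01 sigma_ge1) //; congr nrm.
  apply: (mulIf X0); rewrite -hz /u -/X; field; exact: X0.
apply: core_of_nrm => //; rewrite leNgt; apply/negP => zz.
- have : nrm z <= nrm (z ^+ m).
    by rewrite nrmX -[leLHS]expr1 ler_weXn2l //; lra.
  by have := sigma_le; nra.
- have : nrm (z ^+ m) <= nrm z by apply: nrmX_le => //; lra.
  by have := sigma_ge1; have := nrm_ge0 (z ^+ m); nra.
Qed.

Let T : {poly cplx R} :=
  m%:R *: (X1 * (Q + (rc eps)%:P)) - rc (eps * r%:R) *: 'X.
(* [V] accounts for the critical points 0 and 1, whose orbits end at infinity *)
Let V : {poly cplx R} := rc eta *: ('X^(m.-1) * X1 ^+ r.-1).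

Let wronskianE : wronskian P Q = V * T.
Proof.
have QE : Q = X1 ^+ r.-1 * X1 by rewrite -exprSr prednK.
have XE : 'X^m = 'X^(m.-1) * 'X :> {poly cplx R} by rewrite -exprSr prednK.
have dQ : Q^`() = X1 ^+ r.-1 * r%:R%:P.
  rewrite /Q deriv_exp /X1 derivXsubC mul1r -[LHS]mulr_natr.
  by congr (_ * _); rewrite rmorph_nat.
have dX : ('X^m)^`() = 'X^(m.-1) * m%:R%:P :> {poly cplx R}.
  by rewrite derivXn -[LHS]mulr_natr; congr (_ * _); rewrite rmorph_nat.
rewrite /wronskian /P derivD derivZ derivM dX derivD derivC addr0 dQ.
rewrite /V /T rcM -(rc_nat R r) -!mul_polyC polyCM XE QE.
ring.
Qed.

Let size_T : size T = r.+2.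
Proof.
have X10 : X1 != 0 by rewrite polyXsubC_eq0.
have sz : size (m%:R *: (X1 * (Q + (rc eps)%:P))) = r.+2.
  rewrite size_scale; last by rewrite pnatr_eq0 -lt0n.
  by rewrite size_mul -?size_poly_gt0 ?size_Qeps // size_XsubC.
rewrite /T size_polyDl // sz size_polyN.
by apply: leq_ltn_trans (size_scale_leq _ _) _; rewrite size_polyX !ltnS.
Qed.

Let T_neq0 : T != 0.
Proof. by rewrite -size_poly_gt0 size_T. Qed.

Let eps_r16 : eps * r%:R <= (1 / 2) ^+ r / 16.
Proof.
have d16 : delta1 <= 1 / 16 by have := delta1_le; have := t_le; lra.
apply: (le_trans eps_r); rewrite ler_pM ?exprn_ge0 ?(ltW delta1_gt0) //.
  by rewrite lerXn2r ?nnegrE ?(ltW delta1_gt0) //; lra.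
have -> : 16^-1 = 1 / 16 :> R by lra.
apply: (le_trans _ d16); rewrite -[leRHS]expr1 ler_wiXn2l ?(ltW delta1_gt0) //; lra.
Qed.

(** A root satisfies [m (z-1) ((z-1)^r + eps) = eps r z], and [eps] is tiny: the
    left side is too small when [|z - 1| < delta], and too large when [z] is
    near 0 or far away. *)
Let root_T_core z : root T z -> core z.
Proof.
rewrite /root /T /Q /X1.
rewrite !(hornerD, hornerZ, hornerM, hornerXn, horner_exp, hornerC, hornerN, hornerX).
rewrite subr_eq0 => /eqP /(congr1 (@nrm R)); rewrite !nrmM nrm_nat nrm_rc.
have er0 : 0 <= eps * r%:R by exact: mulr_ge0 (ltW eps_gt0) (ler0n _ _).
rewrite (ger0_norm er0).
have er16 : eps * r%:R <= 1 / 16.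
  apply: (le_trans eps_r16); rewrite ler_pM2r //.
  by rewrite exprn_ile1 //; lra.
set x := z - 1; set N := nrm (x ^+ r + rc eps) => E.
have x0 := nrm_ge0 x; have z0 := nrm_ge0 z.
have zx : nrm z <= nrm x + 1 by have := ler_nrmD x 1; rewrite /x subrK nrm1.
have xz : nrm x <= nrm z + 1 by have := ler_nrmBD z 1; rewrite nrm1.
have xz' : 1 <= nrm x + nrm z.
  by have := ler_nrmD (1 - z) z; rewrite subrK nrm1 nrmB.
have zd : delta <= nrm x.
  rewrite leNgt; apply/negP => xd.
  have N3 : N <= 3 * eps.
    apply: le_trans (ler_nrmD _ _) _; rewrite nrm_rc gtr0_norm // nrmX.
    have : nrm x ^+ r <= delta ^+ r by rewrite lerXn2r ?nnegrE ?nrm_ge0 // ltW.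
    by rewrite delta_r; lra.
  have md : m%:R * nrm x <= 1 / 8.
    have d1s : delta1 ^+ 2 <= 1 by have := delta1_le; have := t_le; have := delta1_gt0; nra.
    have : m%:R * nrm x <= m%:R * delta by rewrite ler_wpM2l // ltW.
    have := delta_mr; rewrite natrD; have : 0 <= delta * r%:R by rewrite mulr_ge0 // ltW.
    by lra.
  have N0 : 0 <= N by exact: nrm_ge0.
  have h1 : m%:R * (nrm x * N) <= 1 / 8 * (3 * eps).
    by rewrite mulrA ler_pM // mulr_ge0.
  have h2 : eps * (1 / 2) <= eps * r%:R * nrm z.
    rewrite -mulrA ler_pM2l //.
    have := delta_le; have := delta1_le; have := t_le => a1 a2 a3.
    have : 1 / 2 <= nrm z by lra.
    by have := r_ge1; nra.
  by have := eps_gt0; lra.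
have [v1 v2] := factor_bounds zd.
have NE : N = nrm x ^+ r * nrm (1 + u z).
  have X0 : x ^+ r != 0 by rewrite expf_neq0 // -nrm_gt0; exact: lt_le_trans zd.
  by rewrite -nrmX -nrmM /N /u -/x; congr nrm; field; exact: X0.
have xr0 : 0 <= nrm x ^+ r by exact: exprn_ge0.
have low : nrm x * (nrm x ^+ r / 2) <= eps * r%:R * nrm z.
  rewrite -E NE; apply: (@le_trans _ _ (nrm x * (nrm x ^+ r * nrm (1 + u z)))).
    by rewrite ler_wpM2l // ler_wpM2l //; lra.
  by rewrite ler_peMl // ?mulr_ge0 ?nrm_ge0.
apply: core_of_nrm => //; rewrite leNgt; apply/negP => zz.
- have x1 : 1 <= nrm x ^+ r by rewrite exprn_ege1 //; lra.
  have : nrm x * (1 / 2) <= nrm x * (nrm x ^+ r / 2) by rewrite ler_wpM2l //; lra.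
  have : eps * r%:R * nrm z <= 1 / 16 * (nrm x + 1) by rewrite ler_pM.
  lra.
- have xh : (1 / 2) ^+ r <= nrm x ^+ r by rewrite lerXn2r ?nnegrE //; lra.
  have : 1 / 2 * ((1 / 2) ^+ r / 2) <= nrm x * (nrm x ^+ r / 2).
    by rewrite ler_pM ?divr_ge0 ?exprn_ge0 //; lra.
  have : eps * r%:R * nrm z <= (1 / 2) ^+ r / 16 * (1 / 2).
    by rewrite ler_pM ?(ltW zz) ?eps_r16.
  have : 0 < (1 / 2) ^+ r :> R by rewrite exprn_gt0 //; lra.
  lra.
Qed.

Let pole1 : root (rden f) 1.
Proof. by rewrite /root /= /Q horner_exp hornerXsubC subrr expr0n gtn_eqF. Qed.

Let root_V_basin z : root V z -> ~ basin f (finpt p) (finpt z).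
Proof.
have B1 : ~ basin f (finpt p) (finpt 1).
  by apply: (pole_notin_basin f_oo); exact/rootP.
rewrite /V rootZ // rootM => /orP[|]; rewrite /root ?hornerXn ?horner_exp expf_eq0.
  move=> /andP[_ /eqP ->] /basin_f; rewrite fE; last by rewrite eq_sym oner_eq0.
  by rewrite expr0n gtn_eqF //= mul0r mulr0 addr0.
by rewrite hornerXsubC subr_eq0 => /andP[_ /eqP ->].
Qed.

Lemma bubble_realization : exists (f : ratfun R) (p : sphere R),
    [/\ ratdeg f = (m + r)%N,
        attracting_fixed_point f p,
        completely_invariant f (immediate_basin f p),
        ~ simply_connected R (immediate_basin f p) &
        num_crit f (immediate_basin f p) = r.+1].
Proof.
exists f, (finpt p).
have half0 : 0 < (1 / 2 : R) by lra.
have circ z : nrm (z - 1) = 1 / 2 -> basin f (finpt p) (finpt z).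
  move=> z1; apply: core_basin; apply: collar_core; split; rewrite z1 //.
  by have := delta1_le; have := t_le; lra.
have [h1 h2 h3 h4] := @basin_criterion R f p 1 p (1 / 2) (t / 2) (1 / 2) V T f_oo
  half01 t2_gt0 contracts_ball (fixed_in_immediate_basin half01 t2_gt0 contracts_ball)
  (fun z fz => core_immediate (fiber_core fz)) pole1 half0 circ T_neq0 wronskianE
  root_V_basin (fun z Tz => core_basin (root_T_core Tz)).
split=> //; last by rewrite h4 size_T.
by rewrite /ratdeg /= size_P size_Q (maxn_idPl _) // ltnS -{1}(add0n r) leq_add2r.
Qed.

End Bubble.

Theorem theoremD (R : realType) (d k : nat) (hd : (3 <= d)%N)
    (hk : (2 <= k <= 2 * d - 2)%N) :
  exists (f : ratfun R) (p : sphere R),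
    [/\ ratdeg f = d,
        attracting_fixed_point f p,
        completely_invariant f (immediate_basin f p),
        ~ simply_connected R (immediate_basin f p) &
        num_crit f (immediate_basin f p) = k].
Proof.
have /andP[k2 kd2] := hk; have k0 : (0 < k)%N by exact: ltnW.
have [kd|dk] := leqP k d.
  have m0 : (0 < d - k.-1)%N by rewrite subn_gt0 prednK.
  have r0 : (0 < k.-1)%N by rewrite -ltnS prednK.
  have := bubble_realization R m0 r0.
  by rewrite subnK ?prednK // (leq_trans (leq_pred k)).
have j0 : (0 < k.+1 - d)%N by rewrite subn_gt0 ltnS ltnW.
have jd : (k.+1 - d < d)%N.
  rewrite ltn_subLR ?(leq_trans (ltnW dk)) //.
  move: kd2; rewrite mul2n -addnn leq_subRL ?add2n //.
  by rewrite (leq_trans _ (leq_addr _ _)) // ltnW.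
have := escaping_realization R j0 jd.
by rewrite subnKC // (leq_trans (ltnW dk)).
Qed.
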